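(* Let $(X_0,\mathcal{M}_{X_0})$ be a toric log Calabi–Yau space with intersection complex $(B,\mathscr{P})$, defined by real lifted open gluing data $s$ (with respect to which it is normalized), with its standard real structure. Let $B'=\bigcup_{\sigma\in\mathscr{P}_{\max}}\operatorname{Int}\sigma\cup\{\text{vertices of }\mathscr{P}\}\subset B$. Then, under the canonical identification $X_0^{KN}|_{B'}=\operatorname{Hom}^\circ(\widehat{\mathcal{P}},U(1))|_{B'}$, the real locus in $X_0^{KN}$ over $B'$ is given by $$X_{0,\mathbb{R}}^{KN}|_{B'}=\operatorname{Hom}^\circ(\widehat{\mathcal{P}},\{\pm1\})|_{B'}\subset\operatorname{Hom}^\circ(\widehat{\mathcal{P}},U(1))|_{B'}.$$
   Context: Kato–Nakayama space: for a log analytic space $(X,\mathcal{M}_X)$ with structure map $\alpha$, $X^{KN}$ is the set of pairs $(x,\theta)$, $x\in X$, $\theta\in\operatorname{Hom}(\mathcal{M}_{X,x}^{gp},U(1))$ with $\theta(h)=h(x)/|h(x)|$ for $h\in\mathcal{O}_{X,x}^\times$, with subbasis of topology $\mathrm{ev}_s^{-1}(V)$ for local sections $s$ of $\mathcal{M}_X$, $V\subset\mathbb{R}_{\ge0}\times U(1)$ open, $\mathrm{ev}_s(x,\theta)=(|\alpha(s)(x)|,\theta(s))$; $\pi:X^{KN}\to X$ is the projection. If $(X,\mathcal{M}_X)$ has a real structure, i.e. an involution $(\iota_X,\iota_X^\flat)$ of log spaces over $\mathbb{R}$ with $\iota_X$ antiholomorphic, the lifted real involution on $X^{KN}$ is $(x,\theta)\mapsto(\iota_X(x),\overline{\theta\circ\iota_X^\flat})$,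 and the real locus $X_{\mathbb{R}}^{KN}$ is its fixed point set. Integral polyhedral manifold $(B,\mathscr{P})$: $B$ is a topological manifold of dimension $n$ underlying a cell complex $\mathscr{P}$ of integral polytopes with attaching maps inclusions of faces preserving the integral affine structure and each cell embedded; $\mathscr{P}_{\max}$ are the $n$-cells, $\Lambda_\tau\simeq\mathbb{Z}^{\dim\tau}$ the integral tangent vectors on $\tau$. Toric log Calabi–Yau space (Gross–Siebert, Mirror symmetry via logarithmic degeneration data I, Def. 4.3): a reduced complex space $X_0$ with irreducible components the projective toric varieties $X_\sigma$ with momentum polytopes $\sigma\in\mathscr{P}_{\max}$, glued torically with toric strata $X_\tau=\bigcap_{\sigma\supseteq\tau}X_\sigma$ the toric variety of polytope $\tau$, with a log structure $\mathcal{M}_{X_0}$ and a log morphism $\delta$ to the standard log point $O^\dagger$ (monoid $\mathbb{N}\oplus\mathbb{C}^\times$) that looks locally like the central fibre of a toric degeneration with divisorial log structure; outside a closed subset $Z\subset(X_0)_{\rm sing}$ of codimension two containing no zero-dimensional toric stratum it is fine saturated and $\delta$ is log smooth, locally the zero locus of a monomial $t=z^{m_0}$ in an affine toric variety. Along the big torus of $X_\rho$, $\rho=\sigma\cap\sigma'$ of codimension one, the log structure is that of the central fibre of $uv=f\cdot t^{\kappa_\rho}$ with $u,v$ restricting to monomials on $X_\sigma,X_{\sigma'}$; $\kappa_\rho\in\mathbb{N}\setminus\{0\}$ and $f=f_{\rho,v}\in\mathbb{C}[\Lambda_\rho]$ is the slab function in the toric coordinates at a vertex $v\in\rho$. Momentum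 map: $\mu:X_0\to B$ is a continuous map restricting on each $X_\sigma$ to an abstract momentum map onto $\sigma$ (invariant under the compact torus, mapping the positive real locus homeomorphically onto $\sigma$ with inverse $s_0$, and with $(\lambda,x)\mapsto\lambda\cdot s_0(x)$ a homeomorphism $\operatorname{Hom}(\Lambda_\sigma,U(1))\times\operatorname{Int}\sigma\simeq X_\sigma\setminus D_\sigma$, $D_\sigma$ the toric boundary). $\mu^{KN}=\mu\circ\pi$, $\mathcal{A}=\mu(Z)$, and $|_{B'}$ denotes the preimage of $B'$ under $\mu^{KN}$. The integral affine structure on the interiors of maximal cells extends canonically to $B\setminus\mathcal{A}$; at a vertex $v$ it is given by the complete fan in $(\overline{\mathcal{M}}^{gp}_{X_0,X_v}/\mathbb{Z}t)\otimes\mathbb{R}$ describing $X_0$ near $X_v$. $\Lambda$, $\check\Lambda$ are the sheaves of integral tangent and cotangent vectors on $B\setminus\mathcal{A}$. Gluing data: $\mathrm{PM}(\tau)$ is the group of tuples $(s_\sigma)_{\sigma\in\mathscr{P}_{\max},\sigma\supseteq\tau}$, $s_\sigma\in\operatorname{Hom}(\Lambda_\sigma,\mathbb{C}^\times)=\check\Lambda_\sigma\otimes\mathbb{C}^\times$, agreeing on $\Lambda_{\sigma\cap\sigma'}$. Open gluing data are $s=(s_e)$ indexed by inclusions $e:\omega\to\tau$ of cells with $s_e\in\mathrm{PM}(\tau)$, $s_{\mathrm{id}}=1$, $s_{f\circ e,\sigma}=s_{f,\sigma}s_{e,\sigma}$; for a vertex $v\in\sigma\in\mathscr P_{\max}$,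 $s_{v,\sigma}$ is the component for $v\to\sigma$. $X_0(B,\mathscr{P},s)$ is obtained by gluing the affine pieces $V(\omega)=\bigcup_{\sigma\supseteq\omega}\operatorname{Spec}\mathbb{C}[C_{\omega,\sigma}\cap\Lambda_\sigma]$ ($C_{\omega,\sigma}$ the cone generated by $\sigma-\omega$) via the open embeddings $V(\tau)\to V(\omega)$ twisted by $z^m\mapsto s_{e,\sigma}(m)z^m$. Lifted open gluing data are open gluing data arising from a Čech $1$-cocycle of $\iota_*\check\Lambda\otimes\mathbb{C}^\times$ for the cover of $B$ by open stars (in the barycentric subdivision) of barycenters of cells, $\iota:B\setminus\Delta\to B$ with $\Delta$ the largest $(n-2)$-dimensional subcomplex of the barycentric subdivision disjoint from vertices and interiors of maximal cells. They are real if they take values in $\check\Lambda_\sigma\otimes\mathbb{R}^\times$. $(X_0,\mathcal{M}_{X_0})$ is normalized with respect to $s$ if $X_0\simeq X_0(B,\mathscr{P},s)$ and every slab function satisfies $f_{\rho,v}(X_v)=1$. For real $s$, $(X_0,\mathcal{M}_{X_0})$ carries a standard real structure: one compatible with the canonical real structure of $O^\dagger$ and inducing the canonical real structures on the toric components. The extension $\widehat{\mathcal{P}}$: $\varphi$ is the multivalued piecewise linear function on $(B,\mathscr{P})$ with kinks $\kappa_\rho$. It defines an integral affine manifold $\mathbb{B}_\varphi$, an $\mathbb{R}$-torsor over $B\setminus\mathcal{A}$ with a canonical piecewise affine section locally representing $\varphi$; the pull-back $\mathcal{P}$ of $\Lambda_{\mathbb{B}_\varphi}$ along this section is an extension of $\Lambda$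 by $\underline{\mathbb{Z}}$ with class $c_1(\varphi)\in H^1(B\setminus\mathcal{A},\check\Lambda)$. $\widehat{\mathcal{P}}$ is the sheaf of monomials $az^p$ ($a\in\mathbb{C}^\times$, $p$ a local section of $\mathcal{P}$) modulo $\mathbb{R}_{>0}$, the extension of $\Lambda$ by $\underline{\mathbb{Z}}\oplus\underline{U(1)}$ with class $(c_1(\varphi),\operatorname{Arg}(s))$, $\operatorname{Arg}(a)=a/|a|$. Concretely over $B'$ it is glued from the trivial sheaves $\Lambda_\sigma\oplus\mathbb{Z}\oplus U(1)$ on maximal cells, at a vertex $v\in\sigma\cap\sigma'$ by $\operatorname{Arg}(s_{v,\sigma'}s_{v,\sigma}^{-1})$ on the $U(1)$-factor and by a local representative of $\varphi$ on the discrete part. $\operatorname{Hom}^\circ(\widehat{\mathcal{P}},U(1))$ is the space of fibrewise homomorphisms $\widehat{\mathcal{P}}_x\to U(1)$ restricting to the identity on $U(1)\subset\widehat{\mathcal{P}}_x$; over $B'$ it is canonically homeomorphic to $X_0^{KN}|_{B'}$, compatibly over each maximal cell with the canonical descriptions of both sides by $\sigma\times\operatorname{Hom}(\Lambda_\sigma\oplus\mathbb{Z},U(1))$. For real $s$, the class $\operatorname{Arg}(s)$ has values in $\{\pm1\}$, so $\widehat{\mathcal{P}}$ is the push-out of an extension $\widehat{\mathcal{P}}_{\mathbb{R}}$ of $\Lambda$ by $\underline{\mathbb{Z}}\oplus\{\pm1\}$; $\operatorname{Hom}^\circ(\widehat{\mathcal{P}},\{\pm1\})$ denotes those elements of $\operatorname{Hom}^\circ(\widehat{\mathcal{P}},U(1))$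 whose restriction to $\widehat{\mathcal{P}}_{\mathbb{R}}$ takes values in $\{\pm1\}$ (in the trivialization $\Lambda_\sigma\oplus\mathbb{Z}\oplus U(1)$ these are the elements of $\operatorname{Hom}(\Lambda_\sigma\oplus\mathbb{Z},\{\pm1\})$). *)

(* Defs.v *)
From HB Require Import structures.
From mathcomp Require Import all_boot all_order all_algebra.
From mathcomp Require Import all_classical all_reals all_analysis.
From mathcomp.real_closed Require Import complex.
Set Implicit Arguments.
Unset Strict Implicit.
Unset Printing Implicit Defensive.
Import Order.TTheory GRing.Theory Num.Theory numFieldNormedType.Exports.
Local Open Scope classical_set_scope.
Local Open Scope ring_scope.

(** ** Generalities *)

(** The complex numbers; the type is a constant so that the topology which
    MathComp-Analysis puts on every [numFieldType] is found on it.  As always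
    in MathComp, the norm of [z : Cx R] is itself an element of [Cx R]. *)
Definition Cx (R : realType) : numClosedFieldType := R[i]%C.

Definition Arg (R : realType) (z : Cx R) : Cx R := z / `|z|.

Definition homeo_on (S T : topologicalType) (A : set S) (D : set T)
    (f : S -> T) : Prop :=
  [/\ set_bij A D f, {within A, continuous f} &
      exists g : T -> S,
        {within D, continuous g} /\ forall x, A x -> g (f x) = x].

Section ComplexAnalysis.
Variable R : realType.
Local Notation C := (Cx R).

Definition holo (N : nat) (F : 'rV[C]_N -> C) (p : 'rV[C]_N) : Prop :=
  \forall q \near p, differentiable F q.

Definition analytic_at (N : nat) (A : set 'rV[C]_N) (p : 'rV[C]_N) : Prop :=
  exists (k : nat) (F : 'I_k -> 'rV[C]_N -> C),
    (forall i, holo (F i) p) /\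
    \forall q \near p, A q <-> forall i, F i q = 0.

End ComplexAnalysis.

(** ** Log analytic spaces

    The underlying space is reduced, so germs of holomorphic functions are
    germs of complex valued functions: [hol x f] says that [f] is holomorphic
    near [x].  The sheaf of monoids is given by its etale space: [stalk x]
    (written additively) is the stalk at [x], and [sec x s] says that the
    family of germs [s] is a section on some neighbourhood of [x].  For
    [a : stalk x], [alpha x a] is the value at [x] of the structure map. *)
Structure logSpace (R : realType) := LogSpace {
  carrier :> topologicalType;
  hol : carrier -> (carrier -> Cx R) -> Prop;
  stalk : carrier -> nmodType;
  sec : carrier -> (forall y : carrier, stalk y) -> Prop;
  alpha : forall x : carrier, stalk x -> Cx R }.

Arguments hol {R l} x f.
Arguments stalk {R l} x.
Arguments sec {R l} x s.
Arguments alpha {R l x} a.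

Section LogSpaces.
Variables (R : realType) (X : logSpace R).
Local Notation C := (Cx R).

(** [phi] is an isomorphism of the open subspace [U] of [X] with an open
    subspace of the reduced analytic set [A] in [C^N]. *)
Definition chart_on (U : set X) (N : nat) (phi : X -> 'rV[C]_N)
    (A : set 'rV[C]_N) : Prop :=
  [/\ open U, set_inj U phi,
      forall y, U y -> A (phi y) /\ {for y, continuous phi},
      forall y (O : set X), U y -> nbhs y O ->
        exists2 W, nbhs (phi y) W & A `&` W `<=` phi @` (O `&` U) &
      forall y (f : X -> C), U y ->
        hol y f <-> exists2 F, holo F (phi y) &
          \forall y' \near y, f y' = F (phi y')].

Definition reduced_complex_space : Prop :=
  hausdorff_space X /\
  forall x : X, exists (U : set X) (N : nat) (phi : X -> 'rV[C]_N) A,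
    [/\ U x, analytic_at A (phi x) & chart_on U phi A].

Definition smooth_at (x : X) : Prop :=
  exists (U : set X) (N : nat) (phi : X -> 'rV[C]_N),
    U x /\ chart_on U phi setT.

Definition analytic_subset (Z : set X) : Prop :=
  closed Z /\
  forall x, exists (k : nat) (f : 'I_k -> X -> C),
    (forall i, hol x (f i)) /\
    \forall y \near x, Z y <-> forall i, f i y = 0.

(** [dim Z < d]: no injective holomorphic map from a nonempty open subset of
    [C^k], [k >= d], has image in [Z]. *)
Definition adim_lt (Z : set X) (d : nat) : Prop :=
  forall (k : nat) (W : set 'rV[C]_k) (g : 'rV[C]_k -> X),
    (d <= k)%N -> open W -> W !=set0 -> set_inj W g ->
    (forall p, W p -> {for p, continuous g} /\
                      forall f, hol (g p) f -> holo (f \o g) p) ->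
    ~ (g @` W `<=` Z).

(** The germ [a] of the monoid sheaf maps, after restriction to the closed
    subspace [Y], to the germ of [f]. *)
Definition restricts_to (Y : set X) (x : X) (a : stalk x) (f : X -> C) :=
  exists s, [/\ sec x s, s x = a &
    \forall y \near x, Y y -> alpha (s y) = f y].

Record log_analytic_space : Prop := {
  las_complex : reduced_complex_space;
  las_sec_open : forall (x : X) s, sec x s -> \forall y \near x, sec y s;
  las_sec_ext : forall (x : X) (s s' : forall y : X, stalk y),
    sec x s -> (\forall y \near x, s y = s' y) -> sec x s';
  las_sec_germ : forall (x : X) (a : stalk x), exists2 s, sec x s & s x = a;
  las_sec_eq : forall (x : X) (s s' : forall y : X, stalk y),
    sec x s -> sec x s' -> s x = s' x -> \forall y \near x, s y = s' y;
  las_sec0 : forall x : X, sec x (fun y => 0);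
  las_secD : forall (x : X) s s', sec x s -> sec x s' ->
    sec x (fun y => s y + s' y);
  las_alpha0 : forall x : X, alpha (0 : stalk x) = 1;
  las_alphaD : forall (x : X) (a b : stalk x),
    alpha (a + b) = alpha a * alpha b;
  las_alpha_hol : forall (x : X) s, sec x s -> hol x (fun y => alpha (s y));
  las_unit : forall (x : X) (f : X -> C), hol x f -> f x != 0 ->
    exists! a : stalk x, restricts_to setT a f }.

(** *** Kato-Nakayama space

    By the universal property of the group completion, a homomorphism
    [M^gp -> U(1)] is the same as a homomorphism of monoids [M -> U(1)].  A
    germ [a] is a unit of the structure sheaf iff [alpha a != 0]. *)
Record KN := MkKN {
  kn_pt : X;
  kn_theta : stalk kn_pt -> C;
  kn_norm : forall a, `|kn_theta a| = 1;
  kn_hom : forall a b, kn_theta (a + b) = kn_theta a * kn_theta b;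
  kn_unit : forall a, alpha a != 0 -> kn_theta a = Arg (alpha a) }.

HB.instance Definition _ := gen_eqMixin KN.
HB.instance Definition _ := gen_choiceMixin KN.

Definition KN_subbase : set (set KN) :=
  [set E | exists (U : set X) (s : forall y : X, stalk y) (V : set (C * C)),
     [/\ open U, forall x, U x -> sec x s, open V &
         E = [set p | U (kn_pt p) /\
                V (`|alpha (s (kn_pt p))|, kn_theta (s (kn_pt p)))]]].

HB.instance Definition _ := isSubBaseTopological.Build KN KN_subbase id.

(** *** Real structures

    [rs_flat x] is the map on stalks [M_{iota x} -> M_x].  Involutivity of the
    sheaf map is expressed on families of germs, which avoids identifying
    the stalks at [x] and [iota (iota x)]. *)
Record realStructure := {
  rs_iota : X -> X;
  rs_flat : forall x : X, stalk (rs_iota x) -> stalk x;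
  rs_continuous : continuous rs_iota;
  rs_iotaK : involutive rs_iota;
  rs_antihol : forall x f, hol (rs_iota x) f ->
    hol x (fun y => (f (rs_iota y))^*);
  rs_flat0 : forall x, rs_flat (0 : stalk (rs_iota x)) = 0;
  rs_flatD : forall x (a b : stalk (rs_iota x)),
    rs_flat (a + b) = rs_flat a + rs_flat b;
  rs_flat_sec : forall x s, sec (rs_iota x) s ->
    sec x (fun y => rs_flat (s (rs_iota y)));
  rs_flat_alpha : forall x (a : stalk (rs_iota x)),
    alpha (rs_flat a) = (alpha a)^*;
  rs_flatK : forall (s : forall y : X, stalk y) (x : X),
    rs_flat (rs_flat (s (rs_iota (rs_iota x)))) = s x }.

Section RealLocus.
Variable rs : realStructure.

Definition kn_conj_theta (p : KN) (a : stalk (rs_iota rs (kn_pt p))) : C :=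
  (kn_theta (rs_flat a))^*.

Lemma kn_conj_norm p a : `|@kn_conj_theta p a| = 1.
Proof. by rewrite /kn_conj_theta norm_conjC kn_norm. Qed.

Lemma kn_conj_hom p a b :
  @kn_conj_theta p (a + b) = kn_conj_theta a * kn_conj_theta b.
Proof. by rewrite /kn_conj_theta rs_flatD kn_hom rmorphM. Qed.

Lemma kn_conj_unit p (a : stalk (rs_iota rs (kn_pt p))) :
  alpha a != 0 -> kn_conj_theta a = Arg (alpha a).
Proof.
move=> a0; rewrite /kn_conj_theta kn_unit rs_flat_alpha ?conjC_eq0 // /Arg.
rewrite norm_conjC rmorphM /= fmorphV; congr (_ * _^-1); first exact: conjCK.
exact: conj_Creal (normr_real _).
Qed.

Definition kn_involution (p : KN) : KN :=
  MkKN (@kn_conj_norm p) (@kn_conj_hom p) (@kn_conj_unit p).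

Definition kn_real_locus : set KN := [set p | kn_involution p = p].

End RealLocus.

(** *** Central fibres with divisorial log structure

    Near [x], the log space [X] with its section [t] is the central fibre
    [tf = 0] of the flat function [tf] on the analytic set [A] in [C^N], with
    the restriction of the divisorial log structure of [A] along [tf = 0].
    The stalk of the latter at [q] consists of the germs [F] of holomorphic
    functions which do not vanish off the central fibre; its restriction
    to the central fibre is the quotient by the units with restriction [1].
    [L y F] is the class of [F] in the stalk at [y]. *)
Definition invertible_off (N : nat) (A : set 'rV[C]_N)
    (tf : 'rV[C]_N -> C) (q : 'rV[C]_N) (F : 'rV[C]_N -> C) : Prop :=
  holo F q /\ \forall q' \near q, A q' -> tf q' != 0 -> F q' != 0.

Definition divisorial_central_fibre (t : forall y : X, stalk y) (x : X)
    (N : nat) (A : set 'rV[C]_N) (tf : 'rV[C]_N -> C)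
    (Psi : X -> 'rV[C]_N) : Prop :=
  exists (U : set X) (L : forall y : X, ('rV[C]_N -> C) -> stalk y),
  let inv y F := invertible_off A tf (Psi y) F in
  U x /\ analytic_at A (Psi x) /\ chart_on U Psi (A `&` [set q | tf q = 0]) /\
  forall y, U y ->
  (* flatness, and reducedness of the central fibre *)
  [/\ holo tf (Psi y),
      \forall q \near Psi y, A q -> closure (A `&` [set q' | tf q' != 0]) q &
      forall F, holo F (Psi y) ->
        (\forall q \near Psi y, A q -> tf q = 0 -> F q = 0) ->
        exists2 G, holo G (Psi y) &
          \forall q \near Psi y, A q -> F q = tf q * G q] /\
  (* the log structure *)
  [/\ forall F G, inv y F -> inv y G -> L y (F \* G) = L y F + L y G,
      forall F, inv y F ->
        sec y (fun y' => L y' F) /\ alpha (L y F) = F (Psi y),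
      L y tf = t y,
      forall a : stalk y, exists2 F, inv y F & L y F = a &
      forall F G, inv y F -> inv y G ->
        L y F = L y G <-> exists2 H, holo H (Psi y) &
          (\forall q \near Psi y, A q -> tf q = 0 -> H q = 1) /\
          (\forall q \near Psi y, A q -> F q = G q * H q)].

(** The points of [Spec C[P]] in [C^N], where the monoid [P] is generated by
    the [g i]. *)
Definition monoid_gen (r N : nat) (g : 'I_N -> 'rV[int]_r) :
    set 'rV[int]_r :=
  [set m | exists a : 'I_N -> nat, m = \sum_i g i *+ a i].

Definition affine_toric (r N : nat) (g : 'I_N -> 'rV[int]_r) :
    set 'rV[C]_N :=
  [set q | exists p : 'rV[int]_r -> C,
     [/\ p 0 = 1,
         forall m m', monoid_gen g m -> monoid_gen g m' ->
           p (m + m') = p m * p m' &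
         q = \row_i p (g i)]].

(** [X] is fine saturated and log smooth over the standard log point at [x]:
    it is the zero locus of [t = z^{m0}] in the affine toric variety of a fine
    saturated monoid [P].  As the log structure is the divisorial one, [m0]
    is in the interior of [P], that is, its zero locus is the whole toric
    boundary. *)
Definition toric_central_fibre (t : forall y : X, stalk y) (x : X) : Prop :=
  exists (r N : nat) (g : 'I_N -> 'rV[int]_r) (a0 : 'I_N -> nat)
    (Psi : X -> 'rV[C]_N),
  let P := monoid_gen g in
  [/\ forall m : 'rV[int]_r, exists m1 m2, [/\ P m1, P m2 & m = m1 - m2],
      forall (m : 'rV[int]_r) k, (0 < k)%N -> P (m *+ k) -> P m,
      forall m, P m -> exists k m',
        P m' /\ (\sum_i g i *+ a0 i) *+ k = m + m' &
      divisorial_central_fibre t x (affine_toric g)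
        (fun q => \prod_i q 0 i ^+ a0 i) Psi].

End LogSpaces.

Arguments KN {R} X.
Arguments realStructure {R} X.

(** ** Integral polyhedral manifolds *)

(** Raw data of a cell complex of integral polytopes: the polytope of the cell
    [c] is the convex hull of the integral points [verts c] in [R^(dim c)],
    [char c] is the map of this polytope to the space, and
    [x |-> x *m incM b c + incb b c] is the inclusion of [b] as a face of [c];
    [incM b c] and [incb b c] are meaningful only if [b] is contained in [c].
    The lattice of integral tangent vectors of [c] is ['rV[int]_(dim c)]. *)
Structure cellComplex (R : realType) := CellComplex {
  cc_space :> topologicalType;
  cell : Type;
  dim : cell -> nat;
  verts : forall c : cell, seq 'rV[int]_(dim c);
  char : forall c : cell, 'rV[R]_(dim c) -> cc_space;
  incM : forall b c : cell, 'M[int]_(dim b, dim c);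
  incb : forall b c : cell, 'rV[int]_(dim c) }.

Arguments dim {R _} _.
Arguments verts {R _} _.
Arguments char {R _} _ _.
Arguments incM {R _} _ _.
Arguments incb {R _} _ _.

Section Polytopes.
Variables (R : realType) (d : nat).

Definition toR k (m : 'M[int]_(k, d)) : 'M[R]_(k, d) := map_mx intr m.

Definition hull (s : seq 'rV[int]_d) : set 'rV[R]_d :=
  [set x | exists w : 'I_(size s) -> R,
     [/\ forall i, 0 <= w i, \sum_i w i = 1 &
         x = \sum_i w i *: toR s`_i]].

Definition is_face (K F : set 'rV[R]_d) : Prop :=
  F !=set0 /\ exists l : 'cV[R]_d,
    F = [set x | K x /\ forall y, K y -> (y *m l) 0 0 <= (x *m l) 0 0].

Definition barycenter (s : seq 'rV[int]_d) : 'rV[R]_d :=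
  (size s)%:R^-1 *: \sum_(v <- s) toR v.

End Polytopes.

Section Polyhedral.
Variables (R : realType) (n : nat) (B : cellComplex R).
Local Notation C := (Cx R).
Local Notation cell := (cell B).
Local Notation tangent c := ('rV[int]_(dim c)).

Definition polytope (c : cell) : set 'rV[R]_(dim c) := @hull R _ (verts c).
Arguments polytope : clear implicits.
Definition cimg (c : cell) : set B := char c @` polytope c.
Definition crelint (c : cell) : set B := char c @` interior (polytope c).
Definition cle (b c : cell) : Prop := cimg b `<=` cimg c.
Definition incl (b c : cell) (x : 'rV[R]_(dim b)) : 'rV[R]_(dim c) :=
  x *m toR R (incM b c) + toR R (incb b c).

Definition is_max (c : cell) : Prop := dim c = n.
Definition is_vertex (c : cell) : Prop := dim c = 0%N.

Record polyhedral_manifold : Prop := {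
  pm_hausdorff : hausdorff_space B;
  pm_countable : @second_countable B;
  pm_manifold : forall b : B, exists (U : set B) (W : set 'rV[R]_n)
    (f : B -> 'rV[R]_n), [/\ open U, U b, open W & homeo_on U W f];
  pm_locally_finite : forall b : B, exists2 U, nbhs b U &
    finite_set [set c : cell | cimg c `&` U !=set0];
  (* [verts c] lists the vertices of a full-dimensional polytope *)
  pm_full : forall c : cell, interior (polytope c) !=set0;
  pm_uniq : forall c : cell, uniq (verts c);
  pm_verts : forall c : cell, forall v, v \in verts c ->
    is_face (polytope c) [set toR R v];
  pm_continuous : forall c : cell, {within polytope c, continuous (char c)};
  pm_injective : forall c : cell, set_inj (polytope c) (char c);
  pm_partition : forall b : B, exists! c : cell, crelint c b;
  pm_faces : forall (c : cell) F, is_face (polytope c) F ->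
    exists b : cell, cimg b = char c @` F;
  pm_incl : forall b c : cell, cle b c ->
    [/\ exists A, incM b c *m A = 1%:M,
        is_face (polytope c) (incl c @` polytope b) &
        forall x, polytope b x -> char c (incl c x) = char b x] }.

(** The set of integral points of the cone generated by [c - b], for a face
    [b] of [c]. *)
Definition cone (b c : cell) : set (tangent c) :=
  [set m | exists (a : R) x y,
     [/\ 0 <= a, polytope c x, polytope b y & toR R m = a *: (x - incl c y)]].
Arguments cone : clear implicits.

Definition Bprime : set B :=
  [set b | (exists2 c, is_max c & crelint c b) \/
           (exists2 v, is_vertex v & cimg v b)].

(** [m] generates the tangent lattice of [c] modulo that of its facet [rho],
    and points into [c]. *)
Definition transversal_generator (rho c : cell) (m : tangent c) : Prop :=
  cone rho c m /\
  forall m' : tangent c, exists (k : int) (l : tangent rho),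
    m' = k *: m + l *m incM rho c.

(** *** The barycentric subdivision *)

(** The open simplex spanned by the barycenters of a chain of cells. *)
Definition is_chain (k : nat) (c : 'I_k.+1 -> cell) : Prop :=
  forall i j : 'I_k.+1, (i < j)%N ->
    cle (c i) (c j) /\ (dim (c i) < dim (c j))%N.

Definition open_simplex (k : nat) (c : 'I_k.+1 -> cell) : set B :=
  [set b | exists w : 'I_k.+1 -> R,
     [/\ forall i, 0 < w i, \sum_i w i = 1 &
         b = char (c ord_max)
               (\sum_i w i *: incl (c ord_max) (barycenter R (verts (c i))))]].

(** The open star of the barycenter of [c]. *)
Definition open_star (c : cell) : set B :=
  [set b | exists (k : nat) (ch : 'I_k.+1 -> cell),
     [/\ is_chain ch, exists i, ch i = c & open_simplex ch b]].

(** A simplex of the subdivision is disjoint from the vertices and from the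
    interiors of maximal cells iff its chain contains no such cell. *)
Definition discriminant : set B :=
  [set b | exists (k : nat) (ch : 'I_k.+1 -> cell),
     [/\ is_chain ch, forall i, (0 < dim (ch i) < n)%N & open_simplex ch b]].

(** *** The affine structure

    [fan v c : Lambda_c -> Lambda_v = Z^n] is the identification of tangent
    lattices for a vertex [v] of a maximal cell [c].  The local system Lambda
    outside the discriminant locus is glued by these maps from [Lambda_c] on
    the interiors of the maximal cells and [Lambda_v] on the open stars of the
    vertices. *)
Definition fan_data := forall v c : cell, 'M[int]_(dim c, n).

Record complete_fan (fan : fan_data) : Prop := {
  cf_iso : forall v c, is_vertex v -> is_max c -> cle v c ->
    exists A, fan v c *m A = 1%:M /\ A *m fan v c = 1%:M;
  cf_face : forall v b c c', is_vertex v -> is_max c -> is_max c' ->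
    cle v b -> cle b c -> cle b c' ->
    incM b c *m fan v c = incM b c' *m fan v c';
  cf_cover : forall v (w : 'rV[int]_n), is_vertex v ->
    exists c (m : tangent c),
      [/\ is_max c, cle v c, cone v c m & w = m *m fan v c];
  cf_meet : forall v c c' (m : tangent c) (m' : tangent c'),
    is_vertex v -> is_max c -> is_max c' -> cle v c -> cle v c' ->
    cone v c m -> cone v c' m' -> m *m fan v c = m' *m fan v c' ->
    exists b (l : tangent b),
      [/\ cle v b, cle b c /\ cle b c', cone v b l, m = l *m incM b c &
          m' = l *m incM b c'] }.

(** [phi v c] is the linear function on [Lambda_v] whose restriction to the
    maximal cell [c] is a local representative at [v] of the multivalued
    piecewise linear function with kinks [kappa]. *)
Definition mpl_data := cell -> cell -> 'cV[int]_n.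

Definition mpl_representative (fan : fan_data) (kappa : cell -> nat)
    (phi : mpl_data) : Prop :=
  (forall v b c c' (l : tangent b), is_vertex v -> is_max c -> is_max c' ->
     cle v b -> cle b c -> cle b c' ->
     l *m incM b c *m fan v c *m phi v c =
     l *m incM b c' *m fan v c' *m phi v c') /\
  (forall v rho c c' (m : tangent c'), is_vertex v -> (dim rho).+1 = n ->
     is_max c -> is_max c' -> c <> c' -> cle v rho -> cle rho c -> cle rho c' ->
     transversal_generator rho m ->
     m *m fan v c' *m (phi v c' - phi v c) = (kappa rho)%:Z%:M).

(** *** Gluing data *)

Definition is_character (d : nat) (h : 'rV[int]_d -> C) : Prop :=
  (forall m m', h (m + m') = h m * h m') /\ forall m, h m != 0.

Definition PM (b : cell) (f : forall c, tangent c -> C) : Prop :=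
  (forall c, is_max c -> cle b c -> is_character (f c)) /\
  (forall a c c' (m : tangent a), is_max c -> is_max c' ->
     cle b a -> cle a c -> cle a c' ->
     f c (m *m incM a c) = f c' (m *m incM a c')).

(** [s b c d] is the component at the maximal cell [d] of the datum for the
    inclusion [b -> c]. *)
Definition gluing_data := forall b c d : cell, tangent d -> C.

Definition open_gluing_data (s : gluing_data) : Prop :=
  [/\ forall b c, cle b c -> PM c (s b c),
      forall c d m, is_max d -> cle c d -> s c c d m = 1 &
      forall a b c d m, is_max d -> cle a b -> cle b c -> cle c d ->
        s a c d m = s b c d m * s a b d m].

(** Sections over [U] of the push-forward of [\check Lambda \otimes C^*] from
    the complement of the discriminant.  The interiors of the maximal cells
    being dense, a section is determined by its values [g b c] at the points
    [b] of the interiors of maximal cells [c]. *)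
Definition colambda_section (fan : fan_data) (U : set B)
    (g : B -> forall c, tangent c -> C) : Prop :=
  forall b, U b -> ~ discriminant b ->
    (forall c, is_max c -> crelint c b ->
       exists h : tangent c -> C, is_character h /\
         \forall b' \near b, crelint c b' -> forall m, g b' c m = h m) /\
    (forall v, is_vertex v -> open_star v b ->
       exists h : 'rV[int]_n -> C, is_character h /\
         \forall b' \near b, forall c, is_max c -> cle v c -> crelint c b' ->
           forall m, g b' c m = h (m *m fan v c)).

Definition lifted_gluing_data (fan : fan_data) (s : gluing_data) : Prop :=
  open_gluing_data s /\
  exists g : cell -> cell -> B -> forall c, tangent c -> C,
  [/\ forall a b, colambda_section fan (open_star a `&` open_star b) (g a b),
      forall a b c d x m, open_star a x -> open_star b x -> open_star c x ->
        is_max d -> crelint d x ->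
        g a c x d m = g a b x d m * g b c x d m &
      forall a b d x m, cle a b -> cle b d -> is_max d ->
        open_star a x -> open_star b x -> crelint d x ->
        s a b d m = g a b x d m].

Definition real_gluing_data (s : gluing_data) : Prop :=
  forall b c d m, cle b c -> cle c d -> is_max d -> s b c d m \is Num.real.

(** The points of the union [V(b)] of the [Spec C[cone b c]] for maximal cells
    [c] containing [b].  [p c m] is the value of the monomial [m] of
    [cone b c]; on the other components it is extended by zero, except for
    the monomials on a common face. *)
Definition Vpoints (b : cell) : set (forall c, tangent c -> C) :=
  [set p | exists (c0 : cell) (chi : tangent c0 -> C),
     [/\ is_max c0 /\ cle b c0,
         chi 0 = 1 /\ (forall m m', cone b c0 m -> cone b c0 m' ->
                         chi (m + m') = chi m * chi m'),
         forall c a (l : tangent a), is_max c -> cle b a -> cle a c ->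
           cle a c0 -> cone b a l ->
           p c (l *m incM a c) = chi (l *m incM a c0) &
         forall c m, p c m != 0 -> is_max c /\
           exists a (l : tangent a),
             [/\ cle b a, cle a c, cle a c0, cone b a l & m = l *m incM a c]]].

End Polyhedral.

Arguments cle {R B} _ _.
Arguments cone {R B} _ _ _.
Arguments open_star {R B} _.
Arguments cimg {R B} _.
Arguments crelint {R B} _.
Arguments polytope {R B} _.
Arguments is_vertex {R B} _.
Arguments is_max {R} n {B} _.
Arguments Bprime {R} n B _.

(** ** Toric log Calabi-Yau spaces *)

(** [chartV b] is the open subset [V(b)] and [zz b x c m] the value at the
    point [x] of [V(b)] of the monomial [m] of [cone b c].  [tsec] is the
    section defining the morphism to the standard log point, [Zsing] the bad
    locus, and [slab rho v] the family of coefficients of [f_{rho,v}]. *)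
Structure toricLogSpace (R : realType) (B : cellComplex R) := ToricLogSpace {
  X0 :> logSpace R;
  chartV : cell B -> set X0;
  zz : cell B -> X0 -> forall c : cell B, 'rV[int]_(dim c) -> Cx R;
  tsec : forall x : X0, stalk x;
  Zsing : set X0;
  kappa : cell B -> nat;
  slab : forall rho v : cell B, 'rV[int]_(dim rho) -> Cx R }.

Arguments chartV {R B} _ _ _.
Arguments zz {R B} _ _ _ _ _.
Arguments tsec {R B} _ _.
Arguments Zsing {R B} _ _.
Arguments kappa {R B} _ _.
Arguments slab {R B} _ _ _ _.

Section ToricLogCY.
Variables (R : realType) (n : nat) (B : cellComplex R).
Variables (s : gluing_data B) (X : toricLogSpace B).
Arguments s : clear implicits.
Local Notation C := (Cx R).
Local Notation cell := (cell B).
Local Notation tangent c := ('rV[int]_(dim c)).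
Local Notation is_max := (is_max n).
Local Notation V := (chartV X).
Local Notation z := (zz X).
Local Notation t := (tsec X).

(** [X] is isomorphic to [X_0(B, P, s)]. *)
Record glued_from : Prop := {
  gl_open : forall b, open (V b);
  gl_cover : forall x, exists b, V b x;
  gl_meet : forall b b' x, V b x -> V b' x ->
    exists c, [/\ cle b c, cle b' c & V c x];
  gl_sub : forall b c, cle b c -> V c `<=` V b;
  gl_twist : forall b c d x m, cle b c -> cle c d -> is_max d -> V c x ->
    cone b d m -> z b x d m = s b c d m * z c x d m;
  gl_bij : forall b, set_bij (V b) (Vpoints n b) (z b);
  (* analytic structure, in terms of a finite set of generating monomials *)
  gl_chart : forall b, exists (N : nat) (g : 'I_N -> {c : cell & tangent c}),
    [/\ forall i, [/\ is_max (tag (g i)), cle b (tag (g i)) &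
                      cone b _ (tagged (g i))],
        forall c m, is_max c -> cle b c -> cone b c m ->
          exists a : 'I_N -> nat, forall p, Vpoints n b p ->
            p c m = \prod_i p _ (tagged (g i)) ^+ a i &
        forall x, V b x -> exists2 U : set X, U x &
          chart_on U (fun y => \row_i z b y _ (tagged (g i)))
            [set q | exists2 p, Vpoints n b p &
                     q = \row_i p _ (tagged (g i))]] }.

(** The big torus of the toric stratum [X_c], and [X_c] itself; for a vertex
    both consist of the zero-dimensional stratum only. *)
Definition torus_orbit (c : cell) : set X :=
  [set x | V c x /\ forall d, V d x -> cle c d -> cle d c].
Definition stratum (c : cell) : set X :=
  [set x | exists2 b, cle b c & torus_orbit b x].

(** The toric coordinate [z^m], [m] in [cone b c], of the component [X_c], as
    a function on its affine chart [X_c `&` V b]; it extends the character [m]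
    of the big torus [V c]. *)
Definition tcoord (b c : cell) (m : tangent c) (x : X) : C :=
  z b x c m / s b c c m.

(** At a vertex [v], the affine structure is given by the fan in
    [M^gp / (O^* + Z t) = Z^n] which describes [X] near [X_v]: [deg] induces
    this isomorphism, and [m *m fan v c] is the class of the germs of the log
    structure that restrict to the monomial [m] on the component [X_c]. *)
Definition vertex_fan (fan : fan_data n B) : Prop :=
  complete_fan fan /\
  forall v x, is_vertex v -> torus_orbit v x ->
  exists deg : stalk x -> 'rV[int]_n,
  [/\ forall a b, deg (a + b) = deg a + deg b,
      forall w, exists a b, w = deg a - deg b,
      forall a b, deg a = deg b <->
        exists (j k : nat) u,
          alpha u != 0 /\ a + t x *+ j = b + t x *+ k + u &
      forall c (m : tangent c) (a : stalk x) h,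
        is_max c -> cle v c -> cone v c m -> hol x h -> h x != 0 ->
        restricts_to (stratum c) a (fun y => h y * z v y c m) ->
        deg a = m *m fan v c].

(** The Laurent polynomial with coefficients [f] at the point [w] of the
    torus. *)
Definition laurent_eval (d : nat) (f : 'rV[int]_d -> C) (w : 'rV[C]_d) : C :=
  \sum_(m \in [set: 'rV[int]_d]) f m * \prod_j (w 0 j ^ m 0 j).

(** Coordinates [u, v, t, w] of [C^(3 + d)]. *)
Definition cu d (q : 'rV[C]_(3 + d)) : C := q 0 (lshift d (inord 0)).
Definition cv d (q : 'rV[C]_(3 + d)) : C := q 0 (lshift d (inord 1)).
Definition ct d (q : 'rV[C]_(3 + d)) : C := q 0 (lshift d (inord 2)).
Definition cw d (q : 'rV[C]_(3 + d)) : 'rV[C]_d := rsubmx q.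

Definition slab_model d (f : 'rV[int]_d -> C) (k : nat) : set 'rV[C]_(3 + d) :=
  [set q | cu q * cv q = laurent_eval f (cw q) * ct q ^+ k /\
           forall j, cw q 0 j != 0].

(** The monomial [m] of [cone rho c] on [V rho], in the toric coordinates at
    the vertex [v] of [rho]. *)
Definition vcoord (v rho c : cell) (m : tangent c) (x : X) : C :=
  s v rho c m * z rho x c m.

(** On the big torus of [X_rho], [X] is the central fibre of
    [u v = f_{rho,v} t^kappa]; here [u = z^m], [v = z^m'] are the monomials in
    the coordinates at the vertex which generate transversally to [rho] and
    are opposite in the affine structure at the vertex. *)
Definition slab_local_form (fan : fan_data n B) : Prop :=
  forall (v rho c c' : cell) (m : tangent c) (m' : tangent c') x,
    is_vertex v -> (dim rho).+1 = n -> is_max c -> is_max c' -> c <> c' ->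
    cle v rho -> cle rho c -> cle rho c' ->
    transversal_generator rho m -> transversal_generator rho m' ->
    m *m fan v c + m' *m fan v c' = 0 -> torus_orbit rho x ->
    divisorial_central_fibre t x (slab_model (slab X rho v) (kappa X rho))
      (@ct (dim rho))
      (fun y => row_mx
         (\row_(i < 3) [:: vcoord v rho m y; vcoord v rho m' y; 0]`_i)
         (\row_j vcoord v rho (row j (incM rho c)) y)).

Record toric_log_CY (fan : fan_data n B) : Prop := {
  cy_log : log_analytic_space X;
  cy_glued : glued_from;
  cy_tsec : forall x, sec x t;
  cy_tsec0 : forall x, alpha (t x) = 0;
  cy_degeneration : forall x, exists N (A : set 'rV[C]_N) tf Psi,
    divisorial_central_fibre t x A tf Psi;
  cy_Z_analytic : analytic_subset (Zsing X);
  cy_Z_sing : forall x, Zsing X x -> ~ smooth_at x;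
  (* [dim Z <= n - 2] *)
  cy_Z_dim : adim_lt (Zsing X) (n - 1);
  cy_Z_vertex : forall v x, is_vertex v -> torus_orbit v x -> ~ Zsing X x;
  cy_toric : forall x, ~ Zsing X x -> toric_central_fibre t x;
  cy_fan : vertex_fan fan;
  cy_kappa : forall rho, (dim rho).+1 = n -> (0 < kappa X rho)%N;
  cy_slab_finite : forall rho v, is_vertex v -> (dim rho).+1 = n ->
    cle v rho -> finite_set [set m | slab X rho v m != 0];
  cy_slab : slab_local_form fan }.

(** All slab functions are regular with value [1] at [X_v], the point at which
    all monomials of [cone v rho] other than [1] vanish. *)
Definition normalized : Prop :=
  forall rho v, is_vertex v -> (dim rho).+1 = n -> cle v rho ->
    (forall m, slab X rho v m != 0 -> cone v rho m) /\ slab X rho v 0 = 1.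

(** The real structure is compatible with the one of the standard log point
    and induces the canonical one on the toric components. *)
Definition standard_real_structure (rs : realStructure X) : Prop :=
  (forall x, rs_flat (t (rs_iota rs x)) = t x) /\
  (forall b c x, is_max c -> cle b c -> stratum c x -> V b x ->
     [/\ stratum c (rs_iota rs x), V b (rs_iota rs x) &
         forall m, cone b c m ->
           tcoord b m (rs_iota rs x) = (tcoord b m x)^*]).

(** *** Momentum maps *)

Definition is_U1_character (d : nat) (h : 'rV[int]_d -> C) : Prop :=
  (forall m m', h (m + m') = h m * h m') /\ forall m, `|h m| = 1.

(** [y = lambda . x] for the action of the compact torus on [X_c]. *)
Definition torus_act (c : cell) (lambda : tangent c -> C) (x y : X) : Prop :=
  stratum c x /\ stratum c y /\
  forall b, cle b c -> V b x -> V b y /\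
    forall m, cone b c m -> tcoord b m y = lambda m * tcoord b m x.

Definition positive_locus (c : cell) : set X :=
  [set x | stratum c x /\
     forall b m, cle b c -> V b x -> cone b c m -> 0 <= tcoord b m x].

Record momentum_map (mu : X -> B) : Prop := {
  mm_continuous : continuous mu;
  mm_strata : forall c, mu @` stratum c = cimg c;
  mm_invariant : forall c lambda x y, is_max c -> is_U1_character lambda ->
    @torus_act c lambda x y -> mu y = mu x;
  mm_section : forall c, is_max c -> exists s0 : B -> X,
    [/\ homeo_on (positive_locus c) (cimg c) mu,
        homeo_on (cimg c) (positive_locus c) s0,
        forall b, cimg c b -> mu (s0 b) = b &
        exists act : {ptws tangent c -> C} * B -> X,
          homeo_on (fun lb : ({ptws tangent c -> C} * B)%type =>
                      is_U1_character (lb.1 : tangent c -> C) /\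
                      crelint c lb.2) (V c) act /\
          forall (lambda : tangent c -> C) b, is_U1_character lambda ->
            crelint c b -> torus_act lambda (s0 b) (act (lambda, b))] }.

End ToricLogCY.

Arguments stratum {R B} X c _.
Arguments tcoord {R B} s X b {c} m x.

(** ** The extension and its homomorphisms to the circle *)

Section HomCirc.
Variables (R : realType) (n : nat) (B : cellComplex R).
Variables (s : gluing_data B) (fan : fan_data n B) (phi : mpl_data n B).
Arguments s : clear implicits.
Local Notation C := (Cx R).
Local Notation cell := (cell B).
Local Notation tangent c := ('rV[int]_(dim c)).

(** The gluing at a vertex [v] of the trivial sheaves [Lambda_c + Z + U(1)] of
    the maximal cells [c], [c'] containing [v]. *)
Definition phat_glue (v c c' : cell) (a : tangent c * int * C)
    (a' : tangent c' * int * C) : Prop :=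
  let: (m, k, u) := a in let: (m', k', u') := a' in
  [/\ m *m fan v c = m' *m fan v c',
      k' = k + (m *m fan v c *m (phi v c - phi v c')) 0 0 &
      u' = u * Arg (s v c' c' m' / s v c c m)].

Definition max_at (b : B) (c : cell) : Prop := is_max n c /\ cimg c b.

(** A homomorphism [Lambda_c + Z + U(1) -> U(1)] which is the identity on
    [U(1)] is of the form [(m, k, u) |-> h m k * u]. *)
Definition hom_ev (d : nat) (h : 'rV[int]_d -> int -> C)
    (a : 'rV[int]_d * int * C) : C := h a.1.1 a.1.2 * a.2.

(** A point of the total space over [Bprime]: a point [hc_pt] and a
    homomorphism on the stalk of the extension at [hc_pt], given in the
    trivialization on each maximal cell containing [hc_pt]. *)
Record HomCirc := MkHomCirc {
  hc_pt : B;
  hc_hom : forall c, max_at hc_pt c -> tangent c -> int -> C;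
  hc_Bprime : Bprime n B hc_pt;
  hc_norm : forall c (H : max_at hc_pt c) m k, `|hc_hom H m k| = 1;
  hc_add : forall c (H : max_at hc_pt c) m m' k k',
    hc_hom H (m + m') (k + k') = hc_hom H m k * hc_hom H m' k';
  hc_glue : forall v c c' (H : max_at hc_pt c) (H' : max_at hc_pt c') a a',
    is_vertex v -> cimg v hc_pt -> `|a.2| = 1 -> phat_glue v a a' ->
    hom_ev (hc_hom H') a' = hom_ev (hc_hom H) a }.

HB.instance Definition _ := gen_eqMixin HomCirc.
HB.instance Definition _ := gen_choiceMixin HomCirc.

(** The total space is covered by the closed pieces over the maximal cells
    [c], which carry the product topology of the trivialization; homomorphisms
    have the topology of pointwise convergence. *)
Definition HomCirc_open (O : set HomCirc) : Prop :=
  forall q c (H : max_at (hc_pt q) c), O q ->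
  exists (W : set B) (ms : seq (tangent c * int)) (e : C),
  [/\ nbhs (hc_pt q) W, 0 < e &
      forall q' (H' : max_at (hc_pt q') c), W (hc_pt q') ->
        (forall a, a \in ms ->
           `|hc_hom H' a.1 a.2 - hc_hom H a.1 a.2| < e) -> O q'].

Lemma HomCirc_openT : HomCirc_open setT.
Proof.
move=> q c H _; exists setT, [::], 1; split => //.
exact: filterT.
Qed.

Lemma HomCirc_openI (O O' : set HomCirc) :
  HomCirc_open O -> HomCirc_open O' -> HomCirc_open (O `&` O').
Proof.
move=> oO oO' q c H [Oq O'q].
have [W [ms [e [Wq e0 OW]]]] := oO q c H Oq.
have [W' [ms' [e' [Wq' e'0 OW']]]] := oO' q c H O'q.
exists (W `&` W'), (ms ++ ms'), (Num.min e e'); split.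
- exact: filterI.
- by rewrite /Order.min; case: ifP.
- have le12 : Num.min e e' <= e /\ Num.min e e' <= e'.
    have cmp : e >=< e' by apply: real_comparable; apply: gtr0_real.
    by rewrite comparable_ge_min // comparable_ge_min // !lexx orbT.
  move=> q' H' [Wq1 Wq2] small; split.
  + apply: (OW _ H') => // a ams.
    by apply: lt_le_trans (small a _) le12.1; rewrite mem_cat ams.
  + apply: (OW' _ H') => // a ams.
    by apply: lt_le_trans (small a _) le12.2; rewrite mem_cat ams orbT.
Qed.

Lemma HomCirc_open_bigU (I : Type) (f : I -> set HomCirc) :
  (forall i, HomCirc_open (f i)) -> HomCirc_open (\bigcup_i f i).
Proof.
move=> of_ q c H [i _ fiq].
have [W [ms [e [Wq e0 OW]]]] := of_ i q c H fiq.
exists W, ms, e; split => // q' H' Wq' small.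
by exists i => //; apply: (OW _ H').
Qed.

HB.instance Definition _ := isOpenTopological.Build HomCirc
  HomCirc_openT HomCirc_openI HomCirc_open_bigU.

(** Elements whose restriction to the real form [Lambda_c + Z + {1, -1}] has
    values in [{1, -1}]. *)
Definition HomCirc_pm1 : set HomCirc :=
  [set q | forall c (H : max_at (hc_pt q) c) m k (u : C),
     u = 1 \/ u = -1 ->
     hom_ev (hc_hom H) (m, k, u) = 1 \/ hom_ev (hc_hom H) (m, k, u) = -1].

End HomCirc.

Section CanonicalIdentification.
Variables (R : realType) (n : nat) (B : cellComplex R).
Variables (s : gluing_data B) (fan : fan_data n B) (phi : mpl_data n B).
Variables (X : toricLogSpace B) (mu : X -> B).

Definition KN_over (D : set B) : set (KN X) := [set p | D (mu (kn_pt p))].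

(** The homeomorphism over [Bprime] which over each maximal cell [c] is
    compatible with the descriptions of both sides by
    [Hom(Lambda_c + Z, U(1))]: on the Kato-Nakayama side, the value of the
    homomorphism at [(m, 0)] is the value of theta at any germ of the log
    structure which restricts on [X_c] to the toric monomial [z^m], and the
    value at [(0, 1)] is that of theta at [t].  In the interior of [c] the
    monomial is a unit, and one obtains the phase of the coordinate [z^m]. *)
Definition canonical_identification
    (Psi : HomCirc s fan phi -> KN X) : Prop :=
  [/\ homeo_on setT (KN_over (Bprime n B)) Psi,
      forall q, mu (kn_pt (Psi q)) = hc_pt q &
      forall q c (H : max_at n (hc_pt q) c),
        hc_hom H 0 1 = kn_theta (tsec X (kn_pt (Psi q))) /\
        forall b (m : 'rV[int]_(dim c)) (a : stalk (kn_pt (Psi q))),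
          cle b c -> chartV X b (kn_pt (Psi q)) -> cone b c m ->
          restricts_to (stratum X c) a (tcoord s X b m) ->
          hc_hom H m 0 = kn_theta a].

End CanonicalIdentification.

(* Main.v *)
From Pilot Require Import Defs.
From mathcomp Require Import all_boot all_order all_algebra.
From mathcomp Require Import all_classical all_reals all_analysis.
From mathcomp Require Import finmap lra ring.
(* Lets [dim] and [incl] denote the operations of cell complexes. *)
Import Pilot.Defs.
Set Implicit Arguments.
Unset Strict Implicit.
Unset Printing Implicit Defensive.
Import Order.TTheory GRing.Theory Num.Theory numFieldNormedType.Exports.
Local Open Scope classical_set_scope.
Local Open Scope ring_scope.

(** Complex conjugation of the values of a homomorphism defines an involution
    [hc_conj] of the total space of homomorphisms to the circle: the gluing
    over a vertex multiplies by the phases Arg(s), which are signs because [s]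
    is real, so it commutes with conjugation.  A number of absolute value one
    is real exactly when it is 1 or -1, hence the fixed points of [hc_conj]
    are the homomorphisms with values in {1, -1} ([pm1_iff_conj_fixed]).  The
    theorem thus says that the canonical identification [Psi] carries
    [hc_conj] to the real involution of the Kato-Nakayama space
    ([involution_Psi]).

    Over the interior of a maximal cell [c] this is a computation
    ([involution_Psi_interior]).  A point with such a momentum lies on the big
    torus of X_c ([momentum_interior]), where the monomials z^m are invertible
    functions.  So the value of the homomorphism at (m, 0) is the
    phase of the coordinate z^m, which the standard real structure conjugates;
    its value at (0, 1) is theta(t), and [t] is real.  Moreover a point of the
    torus and its conjugate differ by the action of the compact torus, so they
    have the same momentum ([momentum_iota]).

    Over a vertex no such explicit formula is used, since it would require
    the local structure of the monoid sheaf at a zero-dimensional stratum.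
    Instead, the homomorphism given on a maximal cell at the vertex is moved
    along a segment into the interior of that cell.  This shows that the
    points over the interiors are dense, for an element and its conjugate
    simultaneously ([hc_interior_dense]).  As [Psi] and the real involution
    are continuous ([kn_involution_continuous]) and the Kato-Nakayama space is
    separated ([KN_separated]), the two sides agree over the vertices as well.

    Both steps rest on one fact about the cell complex: a cell which meets the
    relative interior of another cell contains it ([crelint_cle]).  It follows
    by induction on the dimension from the existence of a supporting
    hyperplane at each boundary point of a polytope ([hull_support]), which is
    an instance of Farkas' lemma ([farkas]). *)

(** * Farkas' lemma *)

Section Farkas.
Variables (R : realType) (d : nat).
Implicit Types (s : seq 'rV[R]_d) (w x : 'rV[R]_d) (l : 'cV[R]_d).

Definition pairing w l : R := (w *m l) 0 0.

Lemma pairingDl w x l : pairing (w + x) l = pairing w l + pairing x l.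
Proof. by rewrite /pairing mulmxDl mxE. Qed.

Lemma pairingNl w l : pairing (- w) l = - pairing w l.
Proof. by rewrite /pairing mulNmx mxE. Qed.

Lemma pairingZl a w l : pairing (a *: w) l = a * pairing w l.
Proof. by rewrite /pairing -scalemxAl mxE. Qed.

Lemma pairingBr w l l' : pairing w (l - l') = pairing w l - pairing w l'.
Proof. by rewrite /pairing mulmxBr !mxE. Qed.

Lemma pairingZr a w l : pairing w (a *: l) = a * pairing w l.
Proof. by rewrite /pairing -scalemxAr mxE. Qed.

Lemma pairing_le0_eq0 w : (forall l, pairing w l <= 0) -> w = 0.
Proof.
move=> w_le0; apply/rowP => i; rewrite mxE.
have ev a : pairing w (a *: delta_mx i 0) = a * w 0 i.
  rewrite pairingZr /pairing; congr (a * _).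
  rewrite mxE (bigD1 i) //= big1 => [|j /negbTE ji].
    by rewrite !mxE !eqxx mulr1 addr0.
  by rewrite !mxE ji mulr0.
have := w_le0 (1 *: delta_mx i 0); have := w_le0 (-1 *: delta_mx i 0).
rewrite !ev; lra.
Qed.

Definition pos_span s w : Prop :=
  exists a : nat -> R, (forall i, 0 <= a i) /\
    w = \sum_(i < size s) a i *: s`_i.

(** Induction on the number of generators, after Bartl.  If some [x] separates
    [w] from the cone over [s] but not from the cone over [v :: s], then
    projecting along [v] onto the hyperplane orthogonal to [x] removes the
    generator [v]; the inequalities that [x] satisfies say that the coefficient
    of [v] recovered at the end is nonnegative. *)
Lemma farkas s w :
  (forall l, (forall v, v \in s -> pairing v l <= 0) -> pairing w l <= 0) ->
  pos_span s w.
Proof.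
have [n] := ubnP (size s); elim: n s w => // n IHn [|v s] w /=.
  move=> _ w_le0.
  exists (fun=> 0); split => //; rewrite big_ord0.
  by apply: pairing_le0_eq0 => l; apply: w_le0.
rewrite ltnS => s_n w_le0.
have [|/existsNP [x /not_implyP [s_le0 /negP w_gt0]]] := pselect
    (forall l, (forall u, u \in s -> pairing u l <= 0) -> pairing w l <= 0).
  move=> /(IHn _ _ s_n) [a [a_ge0 ->]].
  exists (fun i => if i is i'.+1 then a i' else 0); split; first by case.
  by rewrite big_ord_recl /= scale0r add0r.
rewrite -ltNge in w_gt0.
have vx_gt0 : 0 < pairing v x.
  rewrite ltNge; apply: contraTN w_gt0 => vx_le0; rewrite -leNgt.
  by apply: w_le0 => u; rewrite inE => /predU1P[->//|/s_le0].
pose k u := pairing u x / pairing v x.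
have red u l : pairing (u - k u *: v) l =
    pairing u (l - (pairing v l / pairing v x) *: x).
  rewrite pairingDl pairingNl pairingZl pairingBr pairingZr /k; field.
  exact: lt0r_neq0.
pose s' := [seq u - k u *: v | u <- s].
have s'_n : (size s' < n)%N by rewrite size_map.
have /(IHn _ _ s'_n) [a [a_ge0 w_eq]] : forall l,
    (forall u, u \in s' -> pairing u l <= 0) -> pairing (w - k w *: v) l <= 0.
  move=> l s'_le0; rewrite red; apply: w_le0 => u.
  rewrite inE => /predU1P[->|us].
    by rewrite -red /k divff ?lt0r_neq0 // scale1r subrr /pairing mul0mx mxE.
  by rewrite -red; apply: s'_le0; apply/mapP; exists u.
exists (fun i => if i is i'.+1 then a i'
                 else k w - \sum_(j < size s) a j * k s`_j); split.
  case=> //; rewrite subr_ge0.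
  have kw_gt0 : 0 <= k w by rewrite divr_ge0 // ltW.
  apply: le_trans kw_gt0; rewrite sumr_le0 // => j _.
  rewrite mulr_ge0_le0 // /k pmulr_lle0 ?invr_gt0 //.
  by apply: s_le0; rewrite mem_nth.
rewrite big_ord_recl /= scalerBl scaler_suml -[LHS](subrK (k w *: v)) w_eq.
rewrite size_map addrC -addrA; congr (_ + _); rewrite addrC -sumrB.
apply: eq_bigr => j _; rewrite (nth_map 0) // scalerBr scalerA //.
Qed.
End Farkas.

(** * Convex hulls of finitely many points *)

Section Hulls.
Variables (R : realType) (d : nat).
Implicit Types (K : set 'rV[R]_d) (x y z : 'rV[R]_d).

Definition convex_set K : Prop := forall x y (t : R),
  K x -> K y -> 0 <= t <= 1 -> K ((1 - t) *: x + t *: y).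

(** The homothety with center [y] and ratio [t] maps a neighbourhood of [z] in
    [K] to a neighbourhood of the given point; [stretch] is its inverse. *)
Lemma segment_interior K y z (t : R) : convex_set K ->
  K y -> interior K z -> 0 < t <= 1 -> interior K ((1 - t) *: y + t *: z).
Proof.
move=> K_convex Ky Kz /andP[t_gt0 t_le1].
pose stretch u := z + t^-1 *: (u - ((1 - t) *: y + t *: z)).
have stretch_cont : {for (1 - t) *: y + t *: z, continuous stretch}.
  apply: continuousD; first exact: cst_continuous.
  apply: continuousZl_tmp; apply: continuousB; first exact: cvg_id.
  exact: cst_continuous.
have : nbhs ((1 - t) *: y + t *: z) (stretch @^-1` K).
  by apply: stretch_cont; rewrite /stretch subrr scaler0 addr0.
apply: filterS => u Ku.
suff -> : u = (1 - t) *: y + t *: stretch u.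
  by apply: K_convex => //; rewrite ltW.
rewrite /stretch scalerDr scalerA divff ?lt0r_neq0 // scale1r addrA.
by rewrite addrC subrK.
Qed.

Variable s : seq 'rV[int]_d.

Lemma hull_convex : convex_set (@hull R d s).
Proof.
move=> _ _ t [a [a_ge0 a_sum ->]] [b [b_ge0 b_sum ->]] /andP[t_ge0 t_le1].
exists (fun i => (1 - t) * a i + t * b i); split.
- by move=> i; rewrite addr_ge0 // mulr_ge0 // subr_ge0.
- by rewrite big_split /= -!mulr_sumr a_sum b_sum !mulr1 subrK.
- rewrite !scaler_sumr -big_split /=; apply: eq_bigr => i _.
  by rewrite !scalerA scalerDl.
Qed.

Lemma hull_pairing_le l (c : R) x :
  (forall v, v \in s -> pairing (toR R v) l <= c) -> hull s x ->
  pairing x l <= c.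
Proof.
move=> le_c [a [a_ge0 a_sum ->]].
rewrite /pairing mulmx_suml summxE -[c]mul1r -a_sum mulr_suml.
apply: ler_sum => i _; rewrite -[X in X <= _]/(pairing _ _) pairingZl.
by apply: ler_wpM2l => //; apply: le_c; rewrite mem_nth.
Qed.

(** The weight [1 - \sum_i b i] which is left goes to [y]. *)
Lemma hull_comb (b : nat -> R) y : (forall i, 0 <= b i) ->
  \sum_(i < size s) b i <= 1 -> hull s y ->
  hull s (y + \sum_(i < size s) b i *: (toR R s`_i - y)).
Proof.
move=> b_ge0 b_le1 [a [a_ge0 a_sum y_eq]].
set B := \sum_(i < size s) b i in b_le1 *.
exists (fun i : 'I_(size s) => b i + (1 - B) * a i); split.
- by move=> i; rewrite addr_ge0 // mulr_ge0 // subr_ge0.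
- by rewrite big_split /= -mulr_sumr a_sum mulr1 addrC subrK.
- under eq_bigr do rewrite scalerBr.
  rewrite sumrB -scaler_suml -/B.
  under [RHS]eq_bigr do rewrite scalerDl -scalerA.
  rewrite big_split /= -scaler_sumr -y_eq scalerBl scale1r.
  by rewrite addrC -addrA; congr (_ + _); rewrite addrC.
Qed.

(** If no functional were maximal at [y] and smaller at [z], then Farkas' lemma
    would put [y - z] in the cone generated by the [v - y], and the segment
    from [z] to [y] could be prolonged beyond [y] within the hull; but then
    [y] would be an interior point. *)
Lemma hull_support y z : hull s y -> interior (@hull R d s) z ->
  ~ interior (@hull R d s) y ->
  exists l, (forall x, hull s x -> pairing x l <= pairing y l) /\
            pairing z l < pairing y l.
Proof.
move=> Ky Kz nKy; apply: contrapT => no_l; apply: nKy.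
pose s' := [seq toR R v - y | v <- s].
have /farkas [a [a_ge0 yz_eq]] : forall l,
    (forall u, u \in s' -> pairing u l <= 0) -> pairing (y - z) l <= 0.
  move=> l s'_le0; rewrite leNgt; apply/negP => yz_gt0; apply: no_l.
  exists l; split; last by move: yz_gt0; rewrite pairingDl pairingNl subr_gt0.
  move=> x; apply: hull_pairing_le => v vs.
  have := s'_le0 (toR R v - y); rewrite pairingDl pairingNl subr_le0; apply.
  by apply/mapP; exists v.
pose A := \sum_(i < size s) a i.
have A_ge0 : 0 <= A by apply: sumr_ge0.
have A1_gt0 : 0 < A + 1 by rewrite ltr_wpDl.
(* [y] divides the segment from the prolonged point to [z] with the weight
   [e / (1 + e)] at [z], where [e = (A + 1)^-1] is the prolongation. *)
pose t := (A + 2)^-1.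
have Ky' : hull s (y + (A + 1)^-1 *: (y - z)).
  have -> : (A + 1)^-1 *: (y - z) =
      \sum_(i < size s) (a i / (A + 1)) *: (toR R s`_i - y).
    rewrite yz_eq size_map scaler_sumr; apply: eq_bigr => i _.
    by rewrite scalerA mulrC (nth_map 0).
  apply: (hull_comb (b := fun i => a i / (A + 1))) => //.
    by move=> i; rewrite divr_ge0 // ltW.
  by rewrite -mulr_suml ler_pdivrMr // mul1r lerDl.
have -> : y = (1 - t) *: (y + (A + 1)^-1 *: (y - z)) + t *: z.
  apply/rowP => i; rewrite !mxE /t; field; rewrite !lt0r_neq0 // ltr_wpDl //.
apply: segment_interior => //; first exact: hull_convex.
rewrite /t invr_gt0 ltr_wpDl //= invf_le1 ?ltr_wpDl //; lra.
Qed.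
End Hulls.

(** * Cells and their faces *)

Section Cells.
Variables (R : realType) (n : nat) (B : cellComplex R).
Hypothesis B_manifold : polyhedral_manifold n B.
Implicit Types b c d : cell B.

Lemma incl_continuous b c : continuous (@incl R B b c).
Proof.
move=> x.
have mul_cont :
    continuous (fun y : 'rV[R]_(dim b) => y *m toR R (incM b c)).
  have -> : (fun y : 'rV[R]_(dim b) => y *m toR R (incM b c)) =
      (fun y => \sum_i y 0 i *: row i (toR R (incM b c))).
    by apply/funext => y; rewrite mulmx_sum_row.
  have row_cont i : true -> continuous
      (fun y : 'rV[R]_(dim b) => y 0 i *: row i (toR R (incM b c))).
    move=> _ y; apply: continuousZr_tmp; exact: coord_continuous.
  exact: (continuous_big (@add_continuous 'rV[R]_(dim c)) row_cont).
apply: (@continuousD R 'rV[R]_(dim c) _ _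
  (fun=> toR R (incb b c)) x (mul_cont x)); exact: cst_continuous.
Qed.

Lemma incM_rinv b c : cle b c ->
  exists A : 'M[R]_(dim c, dim b), toR R (incM b c) *m A = 1%:M.
Proof.
move=> /(pm_incl B_manifold)[[A incMA] _ _]; exists (toR R A).
by rewrite /toR -map_mxM incMA map_mx1.
Qed.

Lemma incl_inj b c : cle b c -> injective (@incl R B b c).
Proof.
move=> /incM_rinv[A incMA] x y /addIr xy.
by rewrite -[x]mulmx1 -[y]mulmx1 -incMA !mulmxA xy.
Qed.

Lemma cle_dim b c : cle b c -> (dim b <= dim c)%N.
Proof.
move=> /incM_rinv[A incMA].
have : (\rank (toR R (incM b c) *m A) <= \rank A)%N by exact: mxrankM_maxr.
by rewrite incMA mxrank1 => /leq_trans; apply; exact: rank_leq_row.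
Qed.

Lemma incl_polytope b c x : cle b c -> polytope b x -> polytope c (incl c x).
Proof.
move=> /(pm_incl B_manifold)[_ [_ [l faceE]] _] bx.
have : [set incl c u | u in polytope b] (incl c x) by exists x.
by rewrite faceE => -[].
Qed.

Lemma crelint_inj b c x : crelint b x -> crelint c x -> b = c.
Proof.
move=> bx cx; have [a [_ a_uniq]] := pm_partition B_manifold x.
by rewrite -(a_uniq b) // -(a_uniq c).
Qed.

Lemma interior_moves k (K : set 'rV[R]_k) x v : interior K x ->
  exists2 e : R, 0 < e & K (x + e *: v) /\ K (x - e *: v).
Proof.
move=> Kx.
have line_cont : {for 0 : R, continuous (fun e : R => x + e *: v)}.
  apply: continuousD; first exact: cst_continuous.
  by apply: continuousZr_tmp; exact: cvg_id.
have : nbhs (0 : R) ((fun e : R => x + e *: v) @^-1` K).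
  by apply: line_cont; rewrite scale0r addr0.
move=> /nbhs_ballP[e /= e_gt0 ballK].
exists (e / 2); first by rewrite divr_gt0.
split; last rewrite -scaleNr; apply: ballK;
  rewrite /ball /= sub0r ?opprK ?normrN gtr0_norm ?divr_gt0 //; lra.
Qed.

(** A functional that is constant on a full-dimensional face vanishes, so the
    face [b] is all of [c].  The affine inclusion is then a homeomorphism of
    the polytopes, so an interior point of [c] is also one of [b], and the
    relative interiors of distinct cells are disjoint. *)
Lemma cle_dim_eq b c : cle b c -> dim b = dim c -> b = c.
Proof.
move=> bc dim_bc.
have [_ [_ [l faceE]] char_incl] := pm_incl B_manifold bc.
have [A incMA] := incM_rinv bc.
have full : row_full (toR R (incM b c)).
  rewrite /row_full eqn_leq rank_leq_col /=.
  have : (\rank (toR R (incM b c) *m A) <= \rank (toR R (incM b c)))%N.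
    exact: mxrankM_maxl.
  by rewrite incMA mxrank1; apply: leq_trans; rewrite dim_bc.
have [u bu] := pm_full B_manifold b.
have faceP x : polytope b x ->
    forall y, polytope c y -> (y *m l) 0 0 <= (incl c x *m l) 0 0.
  move=> bx; have : [set incl c w | w in polytope b] (incl c x) by exists x.
  by rewrite faceE => -[].
have l0 : l = 0.
  suff : toR R (incM b c) *m l = 0.
    have [A' incMA'] := row_fullP full.
    by move=> Ml0; rewrite -[l]mul1mx -incMA' -mulmxA Ml0 mulmx0.
  have flat (v : 'rV[R]_(dim b)) : (v *m (toR R (incM b c) *m l)) 0 0 = 0.
    have [e e_gt0 [up down]] := interior_moves v bu.
    have bu' := interior_subset bu.
    have inclE (a : R) : (incl c (u + a *: v) *m l) 0 0 =
        (incl c u *m l) 0 0 + a * (v *m (toR R (incM b c) *m l)) 0 0.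
      rewrite /incl !mulmxDl -!scalemxAl !mulmxA !mxE; ring.
    have := faceP _ bu' _ (incl_polytope bc up).
    have := faceP _ bu' _ (incl_polytope bc down).
    rewrite -scaleNr !inclE !gerDl mulNr oppr_le0 => ge0 le0.
    have : e * (v *m (toR R (incM b c) *m l)) 0 0 == 0 by rewrite eq_le ge0 le0.
    by rewrite mulf_eq0 gt_eqF //= => /eqP.
  apply/colP => i; rewrite [RHS]mxE.
  have := flat (delta_mx 0 i); rewrite -rowE mxE => <- //.
have inclE : [set incl c w | w in polytope b] = polytope c.
  rewrite faceE; apply/seteqP; split=> [x []//|x cx]; split => // y _.
  by rewrite l0 !mulmx0.
have [y cy] := pm_full B_manifold c.
have [w bw wy] : [set incl c w | w in polytope b] y.
  by rewrite inclE; exact: interior_subset.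
apply: (@crelint_inj b c (char b w)); last first.
  by exists y => //; rewrite -wy char_incl.
exists w => //.
have : nbhs w (incl c @^-1` polytope c) by apply: incl_continuous; rewrite wy.
apply: filterS => w' /=; rewrite -inclE => -[w'' bw''].
by move=> /(incl_inj bc) <-.
Qed.

(** A boundary point lies on a face cut out by a supporting hyperplane, which
    is a cell of smaller dimension as it misses an interior point. *)
Lemma cimg_crelint c x : cimg c x -> exists2 b, cle b c & crelint b x.
Proof.
have [k] := ubnP (dim c); elim: k c => // k IHk c; rewrite ltnS => dim_k.
move=> [y cy yx]; have [int_y|bdry_y] := pselect (interior (polytope c) y).
  by exists c => //; exists y.
have [z cz] := pm_full B_manifold c.
have [l [le_l lt_l]] := hull_support cy cz bdry_y.
pose F := [set u | polytope c u /\ forall w, polytope c w ->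
                     (w *m l) 0 0 <= (u *m l) 0 0].
have [b bF] : exists b, cimg b = char c @` F.
  by apply: (pm_faces B_manifold); split; [exists y|exists l].
have bc : cle b c by rewrite /cle bF => _ [u [cu _] <-]; exists u.
have dim_bc : (dim b < dim c)%N.
  rewrite ltn_neqAle cle_dim // andbT; apply/eqP => /(cle_dim_eq bc) b_c.
  have cz' := interior_subset cz.
  have cimgE : cimg c = char c @` F by rewrite -bF b_c.
  have : cimg c (char c z) by exists z.
  rewrite cimgE => -[u [cu u_max]] uz.
  have uE : u = z.
    by apply: (pm_injective B_manifold (c := c)) => //; exact: mem_set.
  by move: (u_max y cy); rewrite uE leNgt => /negP; apply.
have /(IHk _ (leq_trans dim_bc dim_k)) [a ab ax] : cimg b x.
  by rewrite bF; exists y.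
by exists a => //; apply: subset_trans ab bc.
Qed.

Lemma crelint_cle b c x : crelint b x -> cimg c x -> cle b c.
Proof.
by move=> bx /cimg_crelint[a ac ax]; rewrite (crelint_inj bx ax).
Qed.

End Cells.

(** * The topology of the Kato-Nakayama space *)

Section KatoNakayama.
Variables (R : realType) (X : logSpace R).
Local Notation C := (Cx R).
Implicit Types p q : KN X.

Lemma KN_subbase_open (E : set (KN X)) : KN_subbase E -> open E.
Proof.
move=> E_sub; exists [set E]; last by rewrite bigcup_set1.
move=> _ ->; exists [fset E]%fset; first by move=> F /fset1P ->; exact: mem_set.
rewrite predeqE => p; split=> [|Ep F /=]; last by rewrite inE => /eqP ->.
by move=> /(_ E); apply; rewrite /= inE.
Qed.

Lemma KN_open_preimage (f : KN X -> KN X) (O : set (KN X)) :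
  (forall E, KN_subbase E -> open (f @^-1` E)) -> open O -> open (f @^-1` O).
Proof.
move=> f_sub [D' D'_fin <-]; rewrite preimage_bigcup.
apply: bigcup_open => A /D'_fin[F F_sub <-]; rewrite preimage_bigcap.
rewrite bigcap_fset big_seq; elim/big_ind : _ => [||E EF]; first exact: openT.
  by move=> A' B' ? ?; exact: openI.
by apply: f_sub; exact: set_mem (F_sub _ EF).
Qed.

Hypothesis X_log : log_analytic_space X.

(** The hypothesis ranges over sections, and not over germs, because the two
    germs to be compared live in the stalks at points that are only
    propositionally equal. *)
Lemma KN_ext p q : kn_pt p = kn_pt q ->
  (forall s, sec (kn_pt p) s ->
     kn_theta (s (kn_pt p)) = kn_theta (s (kn_pt q))) -> p = q.
Proof.
case: p q => [x th n h u] [x' th' n' h' u'] /= xx'.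
move: th' n' h' u'; case: _ / xx' => th' n' h' u' th_sec.
have thE : th = th'.
  apply/funext => a; have [s s_sec <-] := las_sec_germ X_log a.
  exact: th_sec.
move: n' h' u' {th_sec}; rewrite -thE => n' h' u'.
congr MkKN; exact: Prop_irrelevance.
Qed.

(** Points over different [x] are separated on [X], points over the same [x] by
    the phase of a section on which they differ. *)
Lemma KN_separated p q : p <> q ->
  exists A A' : set (KN X), [/\ open A, open A', A p, A' q & A `&` A' = set0].
Proof.
move=> pq; have [X_haus _] := las_complex X_log.
have [pt_eq|/eqP pt_neq] := pselect (kn_pt p = kn_pt q); last first.
  move: X_haus; rewrite open_hausdorff => /(_ _ _ pt_neq).
  move=> [[U U'] /= [Up U'q] [oU oU' /eqP UU']].
  have open_over (W : set X) : open W -> open (@kn_pt R X @^-1` W).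
    move=> oW; apply: KN_subbase_open.
    exists W, (fun=> 0), setT; split=> //; [|exact: openT|].
    - by move=> x _; exact: las_sec0.
    - by apply/seteqP; split=> r //= -[].
  exists (@kn_pt R X @^-1` U), (@kn_pt R X @^-1` U'); split.
  - exact: open_over.
  - exact: open_over.
  - exact: set_mem.
  - exact: set_mem.
  - by rewrite -preimage_setI UU' preimage_set0.
have [s s_sec th_neq] : exists2 s, sec (kn_pt p) s &
    kn_theta (s (kn_pt p)) != kn_theta (s (kn_pt q)).
  apply: contrapT => no_s; apply: pq; apply: KN_ext => // s s_sec.
  by apply: contrapT => /eqP th_neq; apply: no_s; exists s.
have := @norm_hausdorff C C; rewrite open_hausdorff => /(_ _ _ th_neq).
move=> [[V V'] /= [Vp V'q] [oV oV' /eqP VV']].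
have : nbhs (kn_pt p) (fun y => sec y s) by exact: las_sec_open.
rewrite nbhsE => -[U [oU Up] U_sec].
pose ev (W : set C) : set (KN X) :=
  [set r | U (kn_pt r) /\ W (kn_theta (s (kn_pt r)))].
have open_ev W : open W -> open (ev W).
  move=> oW; apply: KN_subbase_open; exists U, s, (snd @^-1` W); split => //.
  by apply: open_comp => // ab _; exact: cvg_snd.
exists (ev V), (ev V'); split; try exact: open_ev.
- by split => //; exact: set_mem.
- by split; [rewrite -pt_eq|exact: set_mem].
- rewrite -subset0 => r [[_ Vr] [_ V'r]].
  by have : (V `&` V') (kn_theta (s (kn_pt r))) by []; rewrite VV'.
Qed.

Lemma conjC_continuous : continuous (fun z : C => z^*).
Proof.
move=> z A /nbhs_ballP[e e_gt0 eA]; apply/nbhs_ballP; exists e => // w zw.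
by apply: eA; move: zw; rewrite /ball /= -rmorphB norm_conjC.
Qed.

Variable rs : realStructure X.

Lemma kn_involution_continuous (O : set (KN X)) :
  open O -> open (kn_involution rs @^-1` O).
Proof.
apply: KN_open_preimage => E [U [s [V [oU s_sec oV ->]]]].
apply: KN_subbase_open.
(* [ev_s] of the image of a point is, up to conjugation of the phase, [ev_s'] of
   the point for the pulled back section [s']; [alpha] is only conjugated and
   keeps its absolute value. *)
exists (rs_iota rs @^-1` U), (fun y => rs_flat (s (rs_iota rs y))),
  ((fun ab => (ab.1, ab.2^*)) @^-1` V); split.
- by apply: open_comp => // x _; exact: rs_continuous.
- move=> x Ux; apply: rs_flat_sec; exact: s_sec.
- apply: open_comp => // -[a b] _.
  have conj_snd : (fun ab : C * C => ab.2^*) @ (a, b) --> b^*.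
    have snd_cont : {for (a, b), continuous (@snd C C)} by exact: cvg_snd.
    exact: (continuous_comp snd_cont (@conjC_continuous b)).
  have fst_cont : {for (a, b), continuous (@fst C C)} by exact: cvg_fst.
  exact: (cvg_pair fst_cont conj_snd).
- apply/seteqP; split => p [Up Vp]; split => //; move: Vp => /=.
    by rewrite rs_flat_alpha (norm_conjC (alpha _)).
  by rewrite rs_flat_alpha (norm_conjC (alpha _)).
Qed.

End KatoNakayama.

(** * Complex conjugation on the homomorphisms to the circle *)

Section Homs.
Variables (R : realType) (n : nat) (B : cellComplex R).
Variables (s : gluing_data B) (fan : fan_data n B) (phi : mpl_data n B).
Local Notation C := (Cx R).
Arguments s : clear implicits.
Local Notation HC := (HomCirc s fan phi).
Implicit Types q : HC.

Lemma vertex_cle (v c : cell B) x :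
  is_vertex v -> cimg v x -> cimg c x -> cle v c.
Proof.
move=> v0 [y vy <-] cx _ [y' vy' <-].
suff -> : y' = y by [].
by apply/rowP => j; have := ltn_ord j; rewrite [X in (_ < X)%N]v0.
Qed.

Lemma HomCirc_ext q q' : hc_pt q = hc_pt q' ->
  (forall c (H : max_at n (hc_pt q) c) (H' : max_at n (hc_pt q') c) m k,
    hc_hom H m k = hc_hom H' m k) -> q = q'.
Proof.
case: q q' => [x h P1 P2 P3 P4] [x' h' P1' P2' P3' P4'] /= xx'.
move: h' P1' P2' P3' P4'; case: _ / xx' => h' P1' P2' P3' P4' h_eq.
have hE : h = h'.
  apply/functional_extensionality_dep => c.
  apply/functional_extensionality_dep => H.
  by apply/funext => m; apply/funext => k; exact: h_eq.
move: P2' P3' P4' {h_eq}; rewrite -hE => P2' P3' P4'.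
congr MkHomCirc; exact: Prop_irrelevance.
Qed.

(** A homomorphism is determined by its values at [(m, 0)] and [(0, 1)], the
    data in terms of which the canonical identification is described. *)
Lemma hc_homE q c (H : max_at n (hc_pt q) c) m k :
  hc_hom H m k = hc_hom H m 0 * hc_hom H 0 1 ^ k.
Proof.
have h00 : hc_hom H 0 0 = 1.
  have := hc_add H 0 0 0 0; rewrite !addr0 => /esym/eqP.
  rewrite -subr_eq0 -{3}[hc_hom H 0 0]mulr1 -mulrBr mulf_eq0 subr_eq0.
  rewrite -normr_eq0 hc_norm oner_eq0 => /eqP //.
have hN (j : nat) : hc_hom H 0 j%:Z = hc_hom H 0 1 ^+ j.
  elim: j => [|j IHj]; first by rewrite h00 expr0.
  have -> : j.+1%:Z = j%:Z + 1 by rewrite -addn1 PoszD.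
  have := hc_add H 0 0 j%:Z 1; rewrite addr0 => ->.
  by rewrite IHj exprSr.
rewrite -[in LHS](addr0 m) -[in LHS](add0r k) hc_add; congr (_ * _).
case: k => j; first exact: hN.
have hj : hc_hom H 0 j.+1%:Z != 0 by rewrite -normr_eq0 hc_norm oner_eq0.
rewrite NegzE -exprnN -hN; apply: (mulIf hj).
by rewrite mulVf // -hc_add addr0 addNr h00.
Qed.

Hypothesis B_manifold : polyhedral_manifold n B.
Hypothesis fan_complete : complete_fan fan.
Hypothesis s_glue : open_gluing_data n s.
Hypothesis s_real : real_gluing_data n s.

Lemma gluing_character b c d :
  is_max n d -> cle b c -> cle c d -> is_character (s b c d).
Proof.
case: s_glue => /(_ b c) sPM _ _ d_max bc cd.
by have [+ _] := sPM bc; apply.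
Qed.

(** The gluing at the vertex is the multiplication with [r], a phase that is
    invariant under conjugation since the gluing data are real. *)
Lemma hc_conj_glue q v c c' (H : max_at n (hc_pt q) c)
    (H' : max_at n (hc_pt q) c') a a' :
  is_vertex v -> cimg v (hc_pt q) -> `|a.2| = 1 ->
  phat_glue s fan phi v a a' ->
  hom_ev (fun m k => (hc_hom H' m k)^*) a' =
  hom_ev (fun m k => (hc_hom H m k)^*) a.
Proof.
move=> v0 vq _; case: a a' => [[m k] u] [[m' k'] u'] [mE kE uE].
have vc : cle v c by case: H => _; exact: vertex_cle.
have vc' : cle v c' by case: H' => _; exact: vertex_cle.
have [c_max _] := H; have [c'_max _] := H'.
pose r := Arg (s v c' c' m' / s v c c m).
have r_real : r^* = r.
  apply: conj_Creal; rewrite /r /Arg rpredM ?rpredV ?normr_real //.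
  by rewrite rpredM ?rpredV //; apply: s_real.
have glue1 : phat_glue s fan phi v (m, k, 1) (m', k', r).
  by split=> //; rewrite mul1r.
have := hc_glue H H' v0 vq _ glue1.
rewrite /hom_ev /= normr1 mulr1 => /(_ erefl) hE.
by rewrite /hom_ev /= uE mulrA mulrAC -hE rmorphM /= r_real.
Qed.

Lemma hc_conj_norm q c (H : max_at n (hc_pt q) c) m k :
  `|(hc_hom H m k)^*| = 1.
Proof. by rewrite norm_conjC hc_norm. Qed.

Lemma hc_conj_add q c (H : max_at n (hc_pt q) c) m m' k k' :
  (hc_hom H (m + m') (k + k'))^* = (hc_hom H m k)^* * (hc_hom H m' k')^*.
Proof. by rewrite hc_add rmorphM. Qed.

Definition hc_conj q : HC :=
  MkHomCirc (hc_Bprime q) (@hc_conj_norm q) (@hc_conj_add q) (@hc_conj_glue q).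

Lemma hc_conjE q c (H : max_at n (hc_pt q) c) m k :
  @hc_hom _ _ _ _ _ _ (hc_conj q) c H m k = (hc_hom H m k)^*.
Proof. by []. Qed.

Lemma pm1_iff_conj_fixed q :
  HomCirc_pm1 (s:=s) (fan:=fan) (phi:=phi) q <-> hc_conj q = q.
Proof.
have pm1P (z : C) : `|z| = 1 -> (z = 1 \/ z = -1) <-> z^* = z.
  move=> z1; split=> [[->|->]|zz]; rewrite ?rmorphN ?rmorph1 //.
  have : z ^+ 2 == 1 by rewrite expr2 -{2}zz -normCK z1 expr1n.
  by rewrite sqrf_eq1 => /orP[/eqP|/eqP]; [left|right].
split=> [q_pm1|qq c H m k u].
  apply: HomCirc_ext => // c H H' m k; rewrite (Prop_irrelevance H' H) /=.
  apply/pm1P; first exact: hc_norm.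
  by have := q_pm1 c H m k 1 (or_introl erefl); rewrite /hom_ev /= mulr1.
have hE : (hc_hom H m k)^* = hc_hom H m k.
  have : forall q', q' = q -> forall (H' : max_at n (hc_pt q') c),
      hc_hom H' m k = hc_hom H m k.
    by move=> _ -> H'; rewrite (Prop_irrelevance H' H).
  by move=> /(_ _ qq H).
have /pm1P [_ /(_ hE)] := hc_norm H m k.
rewrite /hom_ev /= => -[->|->] [->|->];
  by rewrite ?mulr1 ?mul1r ?mulrN1 ?opprK; auto.
Qed.

(** Over the interior of [c] no other maximal cell interferes, so that every
    homomorphism in the trivialization on [c] occurs.  The gluing condition is
    not void in dimension zero, where [c] is itself a vertex. *)
Lemma hc_interior c b (h : 'rV[int]_(dim c) -> int -> C) :
  is_max n c -> crelint c b -> (forall m k, `|h m k| = 1) ->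
  (forall m m' k k', h (m + m') (k + k') = h m k * h m' k') ->
  exists q, hc_pt q = b /\ forall H : max_at n (hc_pt q) c, hc_hom H = h.
Proof.
move=> c_max cb h1 hD.
have eq_c c' : max_at n b c' -> c = c'.
  move=> [c'_max c'b]; apply: (cle_dim_eq B_manifold).
    exact: (crelint_cle B_manifold cb c'b).
  by rewrite c_max c'_max.
(* Homomorphisms are indexed by all maximal cells at [b], which are equal to
   [c] only propositionally. *)
pose cast c' (e : c = c') :=
  eq_rect c (fun c' => 'rV[int]_(dim c') -> int -> C) h c' e.
have cast1 c' e m k : `|@cast c' e m k| = 1.
  by case: c' / e m => m; rewrite /= h1.
have castD c' e m m' k k' :
    @cast c' e (m + m') (k + k') = cast c' e m k * cast c' e m' k'.
  by case: c' / e m m' => m m'; rewrite /= hD.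
pose h' c' (H : max_at n b c') := cast c' (eq_c c' H).
have bB : Bprime n B b by left; exists c.
have h'1 c' (H : max_at n b c') m k : `|h' c' H m k| = 1.
  exact: cast1.
have h'D c' (H : max_at n b c') m m' k k' :
    h' c' H (m + m') (k + k') = h' c' H m k * h' c' H m' k'.
  exact: castD.
have h'g v c1 c2 (H1 : max_at n b c1) (H2 : max_at n b c2) a a' :
    is_vertex v -> cimg v b -> `|a.2| = 1 -> phat_glue s fan phi v a a' ->
    hom_ev (h' c2 H2) a' = hom_ev (h' c1 H1) a.
  move=> v0 vb _.
  have c12 : c1 = c2 by rewrite -(eq_c c1) // -(eq_c c2).
  move: H2 a'; case: c2 / c12 => H2; rewrite (Prop_irrelevance H2 H1).
  case: a => [[m k] u] [[m' k'] u'] [mE -> ->].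
  have [c1_max c1b] := H1.
  have vc1 : cle v c1 by apply: vertex_cle vb c1b.
  have [A [fanA _]] := cf_iso fan_complete v0 c1_max vc1.
  have -> : m' = m by rewrite -[m']mulmx1 -[m]mulmx1 -fanA !mulmxA mE.
  have [_ s_neq0] := gluing_character c1_max vc1 (fun x => id).
  rewrite subrr mulmx0 mxE addr0 divff // /Arg normr1 divr1 mulr1 //.
exists (MkHomCirc bB h'1 h'D h'g); split=> //= H.
by rewrite /h' (Prop_irrelevance (eq_c c H) erefl).
Qed.

(** The same homomorphism on [c], placed over a point of the segment from
    [hc_pt q] to an interior point of [c], converges to [q] when the point
    tends to [hc_pt q]: neighbourhoods in the total space can be tested on the
    single cell [c].  The conjugates converge to the conjugate of [q] for the
    same reason. *)
Lemma hc_interior_dense q c (H : max_at n (hc_pt q) c) (O O' : set HC) :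
  open O -> open O' -> O q -> O' (hc_conj q) ->
  exists q', [/\ crelint c (hc_pt q'), O q' & O' (hc_conj q')].
Proof.
move=> oO oO' Oq O'q.
have [W [ms [e [Wq e0 OW]]]] := oO q c H Oq.
have [W' [ms' [e' [Wq' e'0 OW']]]] := oO' (hc_conj q) c H O'q.
have [c_max [y0 cy0 y0q]] := H.
have [y1 cy1] := pm_full B_manifold c.
pose y (t : R) := (1 - t) *: y0 + t *: y1.
have [t t01 WWt] : exists2 t : R, 0 < t <= 1 & (W `&` W') (char c (y t)).
  have y_cont : {for 0, continuous y}.
    apply: continuousD; apply: continuousZr_tmp; last exact: cvg_id.
    by apply: continuousB; [exact: cst_continuous|exact: cvg_id].
  have : nbhs y0 [set z | polytope c z -> (W `&` W') (char c z)].
    have /subspace_continuousP/(_ y0 cy0) := pm_continuous B_manifold (c := c).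
    have WWq : nbhs (char c y0) (W `&` W') by rewrite y0q; exact: filterI.
    by move=> /(_ _ WWq).
  have y00 : y 0 = y0 by rewrite /y subr0 scale1r scale0r addr0.
  rewrite -y00 => /y_cont/nbhs_ballP[r /= r_gt0 rWW].
  pose t := Num.min (r / 2) 1.
  have t_gt0 : 0 < t by rewrite lt_min ltr01 divr_gt0.
  have t_le1 : t <= 1 by rewrite ge_min lexx orbT.
  exists t; first by rewrite t_gt0.
  apply: (rWW t).
    rewrite /ball /= sub0r normrN gtr0_norm // gt_min ltr_pdivrMr //.
    by rewrite ltr_pMr // ltrDr ltr01.
  apply: hull_convex => //; first exact: interior_subset.
  by rewrite (ltW t_gt0).
have cyt : interior (polytope c) (y t).
  by apply: segment_interior => //; exact: hull_convex.
have [] := @hc_interior c (char c (y t)) (hc_hom H).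
- by [].
- by exists (y t).
- exact: hc_norm.
- exact: hc_add.
move=> q' [q'pt q'hom]; exists q'.
have H' : max_at n (hc_pt q') c.
  by split=> //; rewrite q'pt; exists (y t) => //; exact: interior_subset.
case: WWt => Wt W't; split.
- by rewrite q'pt; exists (y t).
- apply: (OW _ H'); rewrite ?q'pt // => a _.
  by rewrite q'hom subrr normr0.
- apply: (OW' (hc_conj q') H'); rewrite ?q'pt // => a _ /=.
  by rewrite q'hom subrr (normr0 C).
Qed.

End Homs.

(** * Monomials and momenta over the big tori *)

Lemma Arg_conj (R : realType) (z : Cx R) : Arg z^* = (Arg z)^*.
Proof.
by rewrite /Arg norm_conjC rmorphM /= fmorphV /= conj_normC.
Qed.

Section Lattice.
Variables (R : realType) (n : nat) (B : cellComplex R).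
Hypothesis B_manifold : polyhedral_manifold n B.

(** The cone at a cell itself is its whole tangent space, as the polytope has
    interior points. *)
Lemma cone_self (c : cell B) m : cone c c m.
Proof.
have [_ _ char_incl] := pm_incl B_manifold (fun x => id : cimg c x -> cimg c x).
have [y cy] := pm_full B_manifold c.
have cy' := interior_subset cy.
have incl_y : incl c y = y.
  apply: (pm_injective B_manifold (c := c)); last exact: char_incl.
    by apply: mem_set; exact: (incl_polytope B_manifold).
  exact: mem_set.
have [e e_gt0 [cye _]] := interior_moves (toR R m) cy.
exists e^-1, (y + e *: toR R m), y; split=> //; first by rewrite invr_ge0 ltW.
by rewrite incl_y addrC addKr scalerA mulVf ?scale1r // lt0r_neq0.
Qed.

Lemma incM_self_surj (c : cell B) (m : 'rV[int]_(dim c)) :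
  exists l, m = l *m incM c c.
Proof.
have [[A incMA] _ _] := pm_incl B_manifold (fun x => id : cimg c x -> cimg c x).
by exists (m *m A); rewrite -mulmxA (mulmx1C incMA) mulmx1.
Qed.
End Lattice.

Section Toric.
Variables (R : realType) (n : nat) (B : cellComplex R).
Hypothesis B_manifold : polyhedral_manifold n B.
Variables (s : gluing_data B) (X : toricLogSpace B).
Arguments s : clear implicits.
Hypothesis s_glue : open_gluing_data n s.
Hypothesis X_glued : glued_from n s X.
Local Notation C := (Cx R).
Local Notation V := (chartV X).
Local Notation z := (zz X).

Lemma chart_Vpoint b x : V b x -> Vpoints n b (z b x).
Proof. by have [+ _ _] := gl_bij X_glued b; apply. Qed.

Lemma chart_le_max b x : V b x -> exists2 c, is_max n c & cle b c.
Proof. by move=> /chart_Vpoint[c [chi [[? ?] _ _ _]]]; exists c. Qed.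

Lemma chart_dim b x : V b x -> (dim b <= n)%N.
Proof. by move=> /chart_le_max[c <-]; exact: (cle_dim B_manifold). Qed.

(** The orbit is found by taking a chart at [x] of maximal dimension; dimensions
    are bounded since each nonempty chart belongs to a face of a maximal
    cell. *)
Lemma torus_orbit_ex (x : X) : exists b, torus_orbit b x.
Proof.
have [b0 Vb0] := gl_cover X_glued x.
pose P k := `[< exists b, V b x /\ dim b = k >].
have exP : exists k, P k by exists (dim b0); apply/asboolP; exists b0.
have leP k : P k -> (k <= n)%N.
  by move=> /asboolP[b [Vb <-]]; exact: chart_dim Vb.
case: (ex_maxnP exP leP) => k /asboolP[b [Vb dim_b]] k_max.
exists b; split=> // d Vd bd.
suff <- : b = d by [].
apply: (cle_dim_eq B_manifold bd); apply/eqP; rewrite eqn_leq.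
rewrite (cle_dim B_manifold bd) dim_b k_max //; apply/asboolP; by exists d.
Qed.

Lemma torus_orbit_max c x : is_max n c -> V c x -> torus_orbit c x.
Proof.
move=> c_max Vc; split=> // d Vd cd; suff <- : c = d by [].
apply: (cle_dim_eq B_manifold cd); apply/eqP; rewrite eqn_leq.
by rewrite (cle_dim B_manifold cd) c_max (chart_dim Vd).
Qed.

Lemma stratum_max c x : is_max n c -> V c x -> stratum X c x.
Proof. by move=> c_max Vc; exists c => //; exact: torus_orbit_max. Qed.

Lemma tcoord_self c (m : 'rV[int]_(dim c)) x :
  is_max n c -> tcoord s X c m x = z c x c m.
Proof.
by move=> c_max; case: s_glue => _ s1 _; rewrite /tcoord s1 // divr1.
Qed.

Lemma tcoord_char c x : is_max n c -> V c x ->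
  (forall m m' : 'rV[int]_(dim c),
     tcoord s X c (m + m') x = tcoord s X c m x * tcoord s X c m' x) /\
  forall m : 'rV[int]_(dim c), tcoord s X c m x != 0.
Proof.
move=> c_max Vc.
have [c0 [chi [[c0_max cc0] [chi0 chiD] chiE _]]] := chart_Vpoint Vc.
have cE : c = c0.
  by apply: (cle_dim_eq B_manifold cc0); rewrite c_max c0_max.
case: c0 / cE chi c0_max cc0 chi0 chiD chiE => chi _ _ chi0 chiD chiE.
have tE m : tcoord s X c m x = chi m.
  rewrite tcoord_self //; have [l ->] := incM_self_surj B_manifold m.
  by apply: chiE => //; exact: (cone_self B_manifold).
have chiD' m m' : chi (m + m') = chi m * chi m'.
  by apply: chiD; exact: (cone_self B_manifold).
split=> [m m'|m]; first by rewrite !tE.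
rewrite tE; apply/eqP => chim.
have := chiD' m (- m); rewrite subrr chi0 chim mul0r => /eqP.
by rewrite oner_eq0.
Qed.

(** The twist in the gluing of the charts is exactly what is divided out in
    [tcoord]. *)
Lemma tcoord_face b c (m : 'rV[int]_(dim c)) x :
  is_max n c -> cle b c -> V c x -> cone b c m ->
  tcoord s X b m x = tcoord s X c m x.
Proof.
move=> c_max bc Vc bm; rewrite tcoord_self // /tcoord.
rewrite (gl_twist X_glued bc _ c_max Vc bm) //.
rewrite mulrAC divff ?mul1r //.
by have [_] := gluing_character s_glue c_max bc (fun x => id); apply.
Qed.

Lemma holo_monomial N (a : 'I_N -> nat) (p : 'rV[C]_N) :
  holo (fun q : 'rV[C]_N => \prod_i q 0 i ^+ a i) p.
Proof.
have pow_diff i k (q : 'rV[C]_N) :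
    differentiable (fun q : 'rV[C]_N => q 0 i ^+ k : C) q.
  elim: k => [|k IHk]; first exact: differentiable_cst.
  have -> : (fun q : 'rV[C]_N => q 0 i ^+ k.+1 : C) =
      (fun q : 'rV[C]_N => q 0 i : C) * (fun q : 'rV[C]_N => q 0 i ^+ k : C).
    by apply/funext => q'; rewrite exprS.
  by apply: differentiableM => //; exact: differentiable_coord.
apply: (@filterS _ _ (nbhs_filter p) setT) => [q _|]; last exact: filterT.
elim: (index_enum _) => [|i r IHr].
  by under eq_fun do rewrite big_nil; exact: differentiable_cst.
have -> : (fun q : 'rV[C]_N => \prod_(j <- i :: r) q 0 j ^+ a j : C) =
    (fun q : 'rV[C]_N => q 0 i ^+ a i : C) *
    (fun q : 'rV[C]_N => \prod_(j <- r) q 0 j ^+ a j : C).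
  by apply/funext => q'; rewrite big_cons.
exact: differentiableM.
Qed.

(** In the chart [V c] each monomial is a monomial in finitely many coordinate
    functions. *)
Lemma tcoord_hol c (m : 'rV[int]_(dim c)) x :
  is_max n c -> V c x -> hol x (tcoord s X c m).
Proof.
move=> c_max Vc.
have [N [g [_ gen /(_ x Vc)[U Ux [oU _ _ _ holE]]]]] := gl_chart X_glued c.
have [a aE] := gen c m c_max (fun x => id) (cone_self B_manifold m).
apply/(holE x _ Ux); exists (fun q => \prod_i q 0 i ^+ a i).
  exact: holo_monomial.
have : nbhs x (V c).
  by apply: open_nbhs_nbhs; split=> //; exact: (gl_open X_glued).
apply: filterS => y Vy; rewrite tcoord_self // (aE _ (chart_Vpoint Vy)).
by apply: eq_bigr => i _; rewrite mxE.
Qed.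

Hypothesis X_log : log_analytic_space X.

Lemma unit_germ x (f : X -> C) : hol x f -> f x != 0 ->
  exists2 a : stalk x, alpha a = f x & forall Y : set X, restricts_to Y a f.
Proof.
move=> f_hol fx; have [a [[t [t_sec ta tf]] _]] := las_unit X_log f_hol fx.
have tf' : \forall y \near x, alpha (t y) = f y.
  by move: tf; apply: filterS => y; apply.
exists a; first by rewrite -ta; exact: (nbhs_singleton tf').
move=> Y; exists t; split=> //.
by move: tf'; apply: filterS => y.
Qed.

Section Momentum.
Variable mu : X -> B.
Hypothesis mu_momentum : momentum_map n s mu.

(** The orbit [b] of [x] maps into the cell [b], which therefore meets the
    interior of [c] and contains [c]; by maximality of [c] they agree. *)
Lemma momentum_interior c x : is_max n c -> crelint c (mu x) -> V c x.
Proof.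
move=> c_max cx; have [b bx] := torus_orbit_ex x.
have [Vb _] := bx.
have cb : cle c b.
  apply: (crelint_cle B_manifold cx); rewrite -(mm_strata mu_momentum b).
  by exists x => //; exists b.
suff -> : c = b by [].
apply: (cle_dim_eq B_manifold cb); apply/eqP; rewrite eqn_leq.
by rewrite (cle_dim B_manifold cb) c_max (chart_dim Vb).
Qed.

Variable rs : realStructure X.
Hypothesis rs_standard : standard_real_structure n s rs.

(** Conjugation on the big torus multiplies [x] by the element
    [m |-> conj (z^m) / z^m] of the compact torus. *)
Lemma momentum_iota c x : is_max n c -> V c x ->
  [/\ V c (rs_iota rs x), mu (rs_iota rs x) = mu x &
      forall m : 'rV[int]_(dim c),
        tcoord s X c m (rs_iota rs x) = (tcoord s X c m x)^*].
Proof.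
move=> c_max Vc; have cx := stratum_max c_max Vc.
have [_ iotaE] := rs_standard.
have [ciota Viota iota_coord] := iotaE c c x c_max (fun x => id) cx Vc.
have tE (m : 'rV[int]_(dim c)) := iota_coord m (cone_self B_manifold m).
have [tD t0] := tcoord_char c_max Vc.
pose lambda (m : 'rV[int]_(dim c)) := (tcoord s X c m x)^* / tcoord s X c m x.
split=> //; apply: (mm_invariant mu_momentum (lambda := lambda) c_max).
  split=> [m m'|m]; first by rewrite /lambda tD rmorphM invfM mulrACA.
  by rewrite /lambda normrM normfV norm_conjC divff // normr_eq0.
split=> //; split=> // b bc Vb.
have [_ Vb' tbE] := iotaE b c x c_max bc cx Vb; split=> // m bm.
rewrite tbE // (tcoord_face c_max bc Vc bm) /lambda divfK //.
Qed.

Section Identification.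
Variables (fan : fan_data n B) (phi : mpl_data n B).
Hypothesis fan_complete : complete_fan fan.
Hypothesis s_real : real_gluing_data n s.
Variable Psi : HomCirc s fan phi -> KN X.
Hypothesis Psi_canonical : canonical_identification mu Psi.

(** On the big torus [z^m] is a unit, so the germ of the log structure which
    restricts to it exists, and theta is prescribed on units. *)
Lemma hc_hom_phase q c (H : max_at n (hc_pt q) c) m :
  crelint c (hc_pt q) ->
  hc_hom H m 0 = Arg (tcoord s X c m (kn_pt (Psi q))).
Proof.
move=> cq; have [_ mu_Psi Psi_hom] := Psi_canonical.
have [c_max _] := H.
have Vc : V c (kn_pt (Psi q)) by apply: momentum_interior; rewrite ?mu_Psi.
have [_ /(_ m) t0] := tcoord_char c_max Vc.
have [a aE a_res] := unit_germ (tcoord_hol m c_max Vc) t0.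
have [_ /(_ c m a) homE] := Psi_hom q c H.
rewrite homE //; last exact: (cone_self B_manifold).
by rewrite kn_unit aE.
Qed.

(** The image under the real involution lies over the same point of [B], so it
    is [Psi q'] for some [q']; comparing [q'] with the conjugate of [q] only
    involves [z^m] and [t], which generate. *)
Lemma involution_Psi_interior q c : is_max n c -> crelint c (hc_pt q) ->
  kn_involution rs (Psi q) = Psi (hc_conj s_real q).
Proof.
move=> c_max cq.
have [Psi_homeo mu_Psi Psi_hom] := Psi_canonical.
have Vc : V c (kn_pt (Psi q)) by apply: momentum_interior; rewrite ?mu_Psi.
have [Viota mu_iota iota_coord] := momentum_iota c_max Vc.
have [[_ _ Psi_surj] _ _] := Psi_homeo.
have [q' _ q'E] : [set Psi q' | q' in setT] (kn_involution rs (Psi q)).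
  by apply: Psi_surj; rewrite /KN_over /= mu_iota mu_Psi; exact: hc_Bprime.
rewrite -q'E; congr Psi.
have pt_eq : hc_pt q' = hc_pt q by rewrite -mu_Psi q'E /= mu_iota mu_Psi.
have cq' : crelint c (hc_pt q') by rewrite pt_eq.
apply: HomCirc_ext => // c' H' H m k.
have cE : c = c'.
  have [c'_max c'q] := H.
  apply: (cle_dim_eq B_manifold (crelint_cle B_manifold cq c'q)).
  by rewrite c_max c'_max.
case: c' / cE H' H m => H' H m; change (max_at n (hc_pt q) c) in H.
have m_eq : hc_hom H' m 0 = (hc_hom H m 0)^*.
  by rewrite !hc_hom_phase // q'E /= iota_coord Arg_conj.
have t_eq : hc_hom H' 0 1 = (hc_hom H 0 1)^*.
  have [-> _] := Psi_hom q' c H'; have [-> _] := Psi_hom q c H.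
  rewrite q'E /= /kn_conj_theta.
  by have [-> _] := rs_standard.
rewrite hc_conjE (hc_homE H' m k) (hc_homE H m k) m_eq t_eq.
by rewrite rmorphM /= fmorphXz.
Qed.

(** Two continuous maps into a separated space agree if they agree on a dense
    set. *)
Lemma involution_Psi q : kn_involution rs (Psi q) = Psi (hc_conj s_real q).
Proof.
apply: contrapT => /(KN_separated X_log)[A [A' [oA oA' Aq A'q AA']]].
have [[_ Psi_cont _] mu_Psi _] := Psi_canonical.
have Psi_open (O : set (KN X)) : open O -> open (Psi @^-1` O).
  by move: O; apply/continuousP/continuous_subspace_setT.
have [b' b'q] := torus_orbit_ex (kn_pt (Psi q)).
have [c c_max b'c] := chart_le_max b'q.1.
have H : max_at n (hc_pt q) c.
  split=> //; apply: b'c; rewrite -(mm_strata mu_momentum) -mu_Psi.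
  by exists (kn_pt (Psi q)) => //; exists b'.
have oO := Psi_open _ (kn_involution_continuous rs oA).
have [q' [cq' Aq' A'q']] := hc_interior_dense B_manifold fan_complete s_glue H
  oO (Psi_open _ oA') Aq A'q.
have : (A `&` A') (Psi (hc_conj s_real q')).
  by split=> //; rewrite -(involution_Psi_interior c_max cq').
by rewrite AA'.
Qed.

End Identification.
End Momentum.
End Toric.

(** * The real locus *)

Theorem theorem0p6 (R : realType) (n : nat) (B : cellComplex R)
    (B_manifold : polyhedral_manifold n B)
    (s : gluing_data B) (X : toricLogSpace B)
    (fan : fan_data n B)
    (X_logCY : toric_log_CY s X fan)
    (phi : mpl_data n B)
    (phi_mpl : mpl_representative fan (kappa X) phi)
    (s_lifted : lifted_gluing_data fan s)
    (s_real : real_gluing_data n s)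
    (X_normalized : normalized n X)
    (rs : realStructure X)
    (rs_standard : standard_real_structure n s rs)
    (mu : X -> B) (mu_momentum : momentum_map n s mu)
    (Psi : HomCirc s fan phi -> KN X)
    (Psi_canonical : canonical_identification mu Psi) :
  kn_real_locus rs `&` KN_over mu (Bprime n B) =
  Psi @` HomCirc_pm1 (s:=s) (fan:=fan) (phi:=phi).
Proof.
have [[[Psi_fun Psi_inj Psi_surj] _ _] mu_Psi _] := Psi_canonical.
have [fan_complete _] := cy_fan X_logCY.
have conjE q : kn_involution rs (Psi q) = Psi (hc_conj s_real q).
  exact: (involution_Psi B_manifold s_lifted.1 (cy_glued X_logCY)
            (cy_log X_logCY) mu_momentum rs_standard fan_complete s_real
            Psi_canonical).
apply/seteqP; split=> [p [p_real p_over]|_ [q q_pm1 <-]].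
  have [q _ qp] := Psi_surj p p_over; exists q => //.
  apply/(pm1_iff_conj_fixed s_real); apply: Psi_inj; rewrite ?in_setT //.
  by rewrite -conjE qp.
split; last by rewrite /KN_over /= mu_Psi; exact: hc_Bprime.
by rewrite /kn_real_locus /= conjE; congr Psi; apply/pm1_iff_conj_fixed.
Qed.
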